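(* Let $H$ be a collection of probability measures on a measurable space $\mathcal{X}$, let $Q$ be a probability measure on $\mathcal{X}$ with generalized Lebesgue decomposition $Q=Q_a+Q_s$ with respect to $H$, and let $U:[0,\infty]\to[-\infty,\infty]$ be measurable. Assume that $U$ is concave and non-decreasing, and finite on $(0,\infty)$. Suppose that $\varepsilon^*\in\mathcal{E}(H)$ is $U$-optimal and that, for some $a\in(0,1)$, $$\mathrm{E}^{Q_a}\left[U(\varepsilon^* )-U(a\varepsilon^* )\right]<\infty.$$ Then $\varepsilon^*$ satisfies the integrable first-order condition: for every $\varepsilon\in\mathcal{E}(H)$, $\mathrm{D}U(\varepsilon^*;\varepsilon-\varepsilon^* )$ is $Q_a$-integrable and $$\mathrm{E}^{Q_a}\left[\mathrm{D}U(\varepsilon^*;\varepsilon-\varepsilon^* )\right]\le 0.$$ As a consequence, there exist $\lambda^*\in[0,\infty)$ and $P^*\in H^{\mathrm{eff}}$ with $P^*\ll Q_a$ such that $$\varepsilon^*(x)\in\operatorname*{arg\,max}_{z\in[0,\infty)}\left\{U(z)-\lambda^*\frac{dP^*}{dQ_a}(x)\,z\right\},\quad Q_a\text{-a.s.},$$ and $\lambda^*(1-\mathrm{E}^{P^*}[\varepsilon^*])=0$.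
   Context: Notation: $\mathrm{E}^\mu[f]=\int f\,d\mu$ for any nonnegative measure $\mu$; Radon--Nikodym derivatives are taken $[0,\infty)$-valued. Concavity and monotonicity of $U$ are understood on $[0,\infty)$ (valid e-values are finite $Q_a$-a.s., so $U(\infty)$ is immaterial). An event is $H$-negligible if it has probability zero under every $P\in H$. The generalized Lebesgue decomposition of $Q$ with respect to $H$ is $Q=Q_a+Q_s$, where the nonnegative measure $Q_s$ is concentrated on an $H$-negligible event and the nonnegative measure $Q_a$ assigns zero mass to every $H$-negligible event. The class of valid e-values for $H$ is $\mathcal{E}(H)=\{\varepsilon:\mathcal{X}\to[0,\infty]\ \text{measurable}: \mathrm{E}^P[\varepsilon]\le 1\ \text{for all } P\in H\}$. With $M_+$ the collection of nonnegative measures on $\mathcal{X}$, the effective hypothesis is $H^{\mathrm{eff}}=\{P\in M_+: \mathrm{E}^P[\varepsilon]\le 1\ \text{for all } \varepsilon\in\mathcal{E}(H)\}$. A valid e-value $\varepsilon^*\in\mathcal{E}(H)$ is $U$-optimal (against $Q_a$) if, for every $\varepsilon\in\mathcal{E}(H)$, $\mathrm{E}^{Q_a}[U(\varepsilon^* )-U(\varepsilon)]$ is well-defined and $\ge 0$. Here ''well-defined'' means that the integrand avoids an ambiguous $\infty-\infty$ $Q_a$-almost surely, and that its positive part or its negative part has finite $Q_a$-expectation. ($U$-optimality implies that $U(\varepsilon^* )$ is finite $Q_a$-a.s.) For concave $U$ and $\varepsilon^*,\varepsilon\in\mathcal{E}(H)$ with $U(\varepsilon^* )$ $Q_a$-a.s.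 finite, the pointwise one-sided directional derivative is $$\mathrm{D}U(\varepsilon^*;\varepsilon-\varepsilon^* )=\lim_{t\downarrow 0}\frac{U((1-t)\varepsilon^*+t\varepsilon)-U(\varepsilon^* )}{t},$$ which exists $Q_a$-a.s. in the extended reals. *)

(* Defs.v *)
From HB Require Import structures.
From mathcomp Require Export all_boot all_order all_algebra.
From mathcomp Require Export all_classical all_reals all_analysis.
From mathcomp Require Export measurable_realfun.

Set Implicit Arguments.
Unset Strict Implicit.
Unset Printing Implicit Defensive.

Import Order.TTheory GRing.Theory Num.Theory.
Import numFieldNormedType.Exports.

Local Open Scope classical_set_scope.
Local Open Scope ring_scope.
Local Open Scope ereal_scope.

Section hypotheses.
Context {d : measure_display} {X : measurableType d} {R : realType}.
Implicit Types (H : set (probability X R)) (A : set X).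

Definition hyp_negligible H A :=
  measurable A /\ forall P, H P -> P A = 0.

Definition generalized_Lebesgue_decomposition H (Q : probability X R)
    (Qa Qs : {measure set X -> \bar R}) :=
  [/\ forall A, measurable A -> Q A = Qa A + Qs A,
      exists2 N, hyp_negligible H N & Qs (~` N) = 0
    & forall A, hyp_negligible H A -> Qa A = 0].

Definition evalue H : set (X -> \bar R) :=
  [set e : X -> \bar R | [/\ measurable_fun [set: X] e, forall x, 0 <= e x
             & forall P, H P -> \int[P]_x e x <= 1]].

Definition effective_hyp H : set {measure set X -> \bar R} :=
  [set P : {measure set X -> \bar R} | forall e, evalue H e -> \int[P]_x e x <= 1].

End hypotheses.

Section utility.
Context {R : realType}.
(* A function on [0, +oo] is represented by a function on \bar R whose values
   at negative arguments are never used. *)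
Implicit Types U : \bar R -> \bar R.

Definition nondecreasing_nneg U :=
  forall x y : R, (0 <= x)%R -> (x <= y)%R -> U x%:E <= U y%:E.

(* The value U 0 may be -oo.  For a nondecreasing U that is finite on
   ]0, +oo[, no sum of opposite infinities occurs on the left-hand side. *)
Definition concave_nneg U :=
  forall x y t : R, (0 <= x)%R -> (0 <= y)%R -> (0 <= t <= 1)%R ->
    (1 - t)%:E * U x%:E + t%:E * U y%:E <= U ((1 - t) * x + t * y)%:E.

Definition finite_pos U := forall x : R, (0 < x)%R -> U x%:E \is a fin_num.

(* dir_deriv U x y is DU(x; y - x), the limit being taken in \bar R. *)
Definition dir_deriv U (x y : \bar R) : \bar R :=
  lim ((U ((1 - t)%:E * x + t%:E * y) - U x) * (t^-1)%:E @[t --> (0%R : R)^'+]).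

Definition argmax_nneg (g : R -> \bar R) : set R :=
  [set r | (0 <= r)%R /\ forall z, (0 <= z)%R -> g z <= g r].

End utility.

Section optimality.
Context {d : measure_display} {X : measurableType d} {R : realType}.

(* The expectation of f - g makes sense: f - g is almost surely not of the form
   +oo - +oo or -oo - -oo, and its positive or its negative part has finite
   expectation. *)
Definition diff_expectation_def (mu : {measure set X -> \bar R})
    (f g : X -> \bar R) :=
  {ae mu, forall x, f x +? - g x} /\
  (\int[mu]_x ((f \- g)^\+ x) < +oo \/ \int[mu]_x ((f \- g)^\- x) < +oo).

Definition U_optimal (H : set (probability X R))
    (Qa : {measure set X -> \bar R}) (U : \bar R -> \bar R)
    (es : X -> \bar R) :=
  evalue H es /\
  forall e, evalue H e ->
    diff_expectation_def Qa (U \o es) (U \o e) /\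
    0 <= \int[Qa]_x (U (es x) - U (e x)).

Definition integrable_first_order (H : set (probability X R))
    (Qa : {measure set X -> \bar R}) (U : \bar R -> \bar R)
    (es : X -> \bar R) :=
  forall e, evalue H e ->
    Qa.-integrable [set: X] (fun x => dir_deriv U (es x) (e x)) /\
    \int[Qa]_x dir_deriv U (es x) (e x) <= 0.

End optimality.

(* Whenever P `<< Q, this version of the Radon-Nikodym derivative takes its
   values in [0, +oo[ everywhere (f_ge0 and f_fin_num in the same module). *)
Notation RN_deriv P Q := (Radon_Nikodym_SigmaFinite.f P Q).

(* Main.v *)
From HB Require Import structures.
From mathcomp Require Import ring lra.
Require Import Defs.

Set Implicit Arguments.
Unset Strict Implicit.
Unset Printing Implicit Defensive.

Import Order.TTheory GRing.Theory Num.Theory.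
Import numFieldNormedType.Exports.

Local Open Scope classical_set_scope.
Local Open Scope ring_scope.

(** First-order condition. For an e-value [e], the mixtures [(1 - t) es + t e] are
    e-values, so by optimality the difference quotients of [U] from [es] towards
    [e] have nonpositive expectation. By concavity they increase as [t] decreases
    to 0, and they are bounded below by a multiple of [U (a es) - U es], which is
    integrable by hypothesis. Monotone convergence gives integrability of the
    directional derivative and the sign of its expectation
    ([optimum_first_order]).

    Price. If [U] were differentiable, [p = U' (es)] would satisfy
    [E (p e) <= E (p es)] for every e-value, and the normalization of [p Qa] would
    be the measure sought. In general a supergradient has to be selected at each
    point, and the same selection must serve all e-values. Where [es] is nonzero
    write [e = es w]; the directional derivative towards [e] is
    [- max (a (1 - w)) (b (1 - w))], where [a <= b] are [es] times the right and
    left derivatives of [U] at [es] ([dir_deriv_scaled]). Thus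
    [S v = E (max (a v) (b v))] is a sublinear functional of the simple function
    [v], and the first-order condition says that [S] dominates a convex cone of
    linear constraints indexed by the e-values ([constraint_le_support]).

    By the theorem of Mazur and Orlicz ([mazur_orlicz]), some linear functional
    [L <= S] satisfies the same constraints. On indicators [L] lies between the
    integrals of [a] and [b]; hence it is countably additive and has a density [q]
    with [a <= q <= b] ([sfun_functional_density]). The price equal to [q / es]
    where [es] is nonzero and to the right derivative of [U] at 0 elsewhere is a
    supergradient of [U] at [es] almost surely, and [E (p e) <= lam = E (p es)] for
    every e-value [e] ([supporting_price]). The measure with density [p / lam] is
    the required one: the supergradient inequality is the maximality of [es], and
    the budget inequality is membership in the effective hypothesis. If [lam = 0]
    then [p] vanishes almost surely and the null measure serves. *)

(** * The Mazur-Orlicz theorem *)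

Section mazur_orlicz.
Context {R : realType} {V : lmodType R}.
Implicit Types (S T : V -> R) (K : set (V * R)).

Definition sublinear S :=
  (forall u v, S (u + v) <= S u + S v) /\
  (forall (c : R) v, 0 < c -> S (c *: v) = c * S v).

Definition convex_cone K :=
  [/\ K !=set0, forall k l, K k -> K l -> K (k.1 + l.1, k.2 + l.2)
    & forall (c : R) k, 0 < c -> K k -> K (c *: k.1, c * k.2)].

Lemma sublinear0 S : sublinear S -> S 0 = 0.
Proof. by move=> [_ /(_ 2 0)]; rewrite scaler0 => /(_ ltac:(by [])) h; lra. Qed.

Lemma sublinear_oppr S v : sublinear S -> - S (- v) <= S v.
Proof.
move=> sS; have := sS.1 v (- v); rewrite subrr (sublinear0 sS) => h; lra.
Qed.

(** [T] is the infimal convolution [T u = inf (S (u + k.1) - k.2)] over [k] in [K];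
    the choice [u = - k.1] gives the constraint. It is finite because [S]
    dominates [K], and it lies below [S] because small multiples of an element of
    [K] tend to the apex. *)
Lemma sublinear_refine S K : sublinear S -> convex_cone K ->
  (forall k, K k -> k.2 <= S k.1) ->
  exists T, [/\ sublinear T, forall v, T v <= S v
              & forall k, K k -> T (- k.1) <= - k.2].
Proof.
move=> sS [[k0 Kk0] KD KZ] KS.
pose F u : set R := [set S (u + k.1) - k.2 | k in K].
have F0 u : F u !=set0 by exists (S (u + k0.1) - k0.2), k0.
have Flb u : has_lbound (F u).
  exists (- S (- u)) => _ [k Kk <-].
  have := sS.1 (u + k.1) (- u); rewrite addrAC subrr add0r => h.
  have := KS _ Kk; lra.
have Fle u k : K k -> inf (F u) <= S (u + k.1) - k.2.
  by move=> Kk; apply: ge_inf => //; exists k.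
have FZ c u : 0 < c -> inf (F (c *: u)) <= c * inf (F u).
  move=> c0; rewrite mulrC -ler_pdivrMr//.
  apply: lb_le_inf => // _ [k Kk <-]; rewrite ler_pdivrMr//.
  have := Fle (c *: u) _ (KZ _ _ c0 Kk); rewrite /= -scalerDr sS.2//; lra.
exists (fun u => inf (F u)); split.
- split=> [u v|c v c0].
    rewrite -lerBlDr; apply: lb_le_inf => // _ [k Kk <-].
    rewrite lerBlDr -lerBlDl; apply: lb_le_inf => // _ [l Kl <-].
    rewrite lerBlDl; apply: le_trans (Fle _ _ (KD _ _ Kk Kl)) _ => /=.
    by rewrite addrACA; have := sS.1 (u + k.1) (v + l.1); lra.
  apply/eqP; rewrite eq_le FZ//=.
  have ci0 : 0 < c^-1 by rewrite invr_gt0.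
  have := FZ _ (c *: v) ci0; rewrite scalerA mulVf ?gt_eqF// scale1r.
  by rewrite mulrC ler_pdivlMr// mulrC.
- move=> v; apply/ler_addgt0Pr => e e0.
  (* k0 is scaled so that the loss S k0.1 - k0.2 becomes at most e; the + 1
     avoids a null denominator *)
  have D0 : 0 < S k0.1 - k0.2 + 1 by have := KS _ Kk0; lra.
  have d0 := divr_gt0 e0 D0.
  have := Fle v _ (KZ _ _ d0 Kk0); have := sS.1 v (e / (S k0.1 - k0.2 + 1) *: k0.1).
  rewrite /= sS.2//; have : e / (S k0.1 - k0.2 + 1) * (S k0.1 - k0.2 + 1) = e.
    by rewrite divfK// gt_eqF.
  nra.
- by move=> k Kk; have := Fle (- k.1) _ Kk; rewrite addNr (sublinear0 sS) sub0r.
Qed.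

(** By Zorn: a chain of sublinear functionals below [S] is bounded below at [u]
    by [- S (- u)], and its pointwise infimum is subadditive since two members
    of a chain are both above the smaller of the two. *)
Lemma sublinear_minimal S : sublinear S ->
  exists T, [/\ sublinear T, forall v, T v <= S v &
    forall T', sublinear T' -> (forall v, T' v <= T v) -> T' = T].
Proof.
move=> sS; pose W := {T | sublinear T /\ forall v, T v <= S v}.
pose leW (T T' : W) := `[< forall v, sval T' v <= sval T v >].
have leWP (T T' : W) : reflect (forall v, sval T' v <= sval T v) (leW T T').
  exact: asboolP.
have [||||T Tmin] := @Zorn W leW.
- by move=> T; apply/leWP.
- by move=> T1 T2 T3 /leWP h1 /leWP h2; apply/leWP => v; exact: le_trans (h1 v).
- move=> [T1 h1] [T2 h2] /leWP/= le1 /leWP/= le2; apply: eq_exist.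
  by apply/funext => v; apply/eqP; rewrite eq_le le1 le2.
- move=> A Atot; have [[T0 AT0]|A0] := pselect (A !=set0); last first.
    exists (exist _ S (conj sS (fun=> lexx _))) => T AT.
    by absurd False => //; apply: A0; exists T.
  pose F u : set R := [set sval T u | T in A].
  have F0 u : F u !=set0 by exists (sval T0 u), T0.
  have Flb u : has_lbound (F u).
    exists (- S (- u)) => _ [T AT <-].
    have := sublinear_oppr u (svalP T).1; have := (svalP T).2 (- u); lra.
  have Fle u (T : W) : A T -> inf (F u) <= sval T u.
    by move=> AT; apply: ge_inf => //; exists T.
  have sF : sublinear (fun u => inf (F u)).
    split=> [u v|c u c0].
      rewrite -lerBlDr; apply: lb_le_inf => // _ [T AT <-].
      rewrite lerBlDr -lerBlDl; apply: lb_le_inf => // _ [T' AT' <-].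
      rewrite lerBlDl.
      have [/leWP h|/leWP h] := Atot _ _ AT AT'.
        apply: le_trans (Fle _ _ AT') _; have := (svalP T').1.1 u v.
        by have := h u; lra.
      apply: le_trans (Fle _ _ AT) _; have := (svalP T).1.1 u v.
      by have := h v; lra.
    apply/eqP; rewrite eq_le; apply/andP; split.
      rewrite mulrC -ler_pdivrMr//; apply: lb_le_inf => // _ [T AT <-].
      by rewrite ler_pdivrMr// mulrC -(svalP T).1.2// Fle.
    apply: lb_le_inf => // _ [T AT <-].
    by rewrite (svalP T).1.2// ler_pM2l// Fle.
  have FS u : inf (F u) <= S u by exact: le_trans (Fle _ _ AT0) ((svalP T0).2 u).
  pose T1 : W := exist _ (fun u => inf (F u)) (conj sF FS).
  by exists T1 => T AT; apply/leWP => v /=; exact: Fle.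
exists (sval T); split; [exact: (svalP T).1|exact: (svalP T).2|].
move=> T' sT' leT'.
have T'S v : T' v <= S v := le_trans (leT' v) ((svalP T).2 v).
pose T1 : W := exist _ T' (conj sT' T'S).
by rewrite -(Tmin T1)//; apply/leWP.
Qed.

(** Refining a minimal [T] by the ray through [(v, T v)] cannot make it smaller,
    and the refinement takes at [- v] a value at most [- T v]; so [T] is odd, and
    an odd sublinear functional is linear. *)
Lemma minimal_sublinear_scalar T : sublinear T ->
  (forall T', sublinear T' -> (forall v, T' v <= T v) -> T' = T) -> scalar T.
Proof.
move=> sT Tmin.
have TN v : T (- v) = - T v.
  apply/eqP; rewrite eq_le -lerNl sublinear_oppr// andbT.
  pose K : set (V * R) := [set (c *: v, c * T v) | c in [set c : R | 0 < c]].
  have [||T' [sT' T'T T'K]] := @sublinear_refine T K sT.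
  - split; first by exists (1 *: v, 1 * T v); exists 1 => //=.
    + move=> _ _ [c /= c0 <-] [c' /= c'0 <-] /=.
      by exists (c + c'); rewrite /= ?addr_gt0// scalerDl mulrDl.
    + move=> c _ /= c0 [c' /= c'0 <-] /=.
      by exists (c * c'); rewrite /= ?mulr_gt0// scalerA mulrA.
  - by move=> _ [c /= c0 <-] /=; rewrite sT.2.
  - move: T'K; rewrite (Tmin _ sT' T'T) => /(_ (v, T v)); apply.
    by exists 1; rewrite /= ?scale1r ?mul1r.
have TD u v : T (u + v) = T u + T v.
  apply/eqP; rewrite eq_le sT.1/=.
  by have := sT.1 (u + v) (- v); rewrite addrK TN; lra.
move=> c u v; rewrite TD; congr (_ + _).
have [c0|c0|->] := ltgtP c 0; last by rewrite scale0r mul0r sublinear0.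
- by rewrite -[c]opprK scaleNr TN sT.2 ?oppr_gt0// !mulNr.
- exact: sT.2.
Qed.

(** Refining [S] by the constraints and then passing to a minimal functional
    keeps the constraints, because only smaller values at [- k.1] are taken. *)
Theorem mazur_orlicz S K : sublinear S -> convex_cone K ->
  (forall k, K k -> k.2 <= S k.1) ->
  exists L : V -> R, [/\ scalar L, forall v, L v <= S v
                       & forall k, K k -> k.2 <= L k.1].
Proof.
move=> sS cK KS; have [T [sT TS TK]] := sublinear_refine sS cK KS.
have [L [sL LT Lmin]] := sublinear_minimal sT.
have linL := minimal_sublinear_scalar sL Lmin.
exists L; split=> // [v|k Kk]; first exact: le_trans (LT v) (TS v).
have := linL (-1) k.1 0; rewrite addr0 scaleN1r mulN1r (sublinear0 sL) addr0.
by have := LT (- k.1); have := TK _ Kk; lra.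
Qed.

End mazur_orlicz.

(** * Linear functionals on simple functions given by densities *)

Section sfun_lmodule.
Context d (X : measurableType d) (R : realType).
Import HBSimple.

Lemma sfun_scaler_closed : scaler_closed (@sfun d X R).
Proof.
move=> a f fS; have -> : a *: f = (@cst_sfun d X R a : X -> R) * f by [].
exact: rpredM (valP (@cst_sfun d X R a)) fS.
Qed.

HB.instance Definition _ :=
  GRing.isScaleClosed.Build _ _ (@sfun d X R) sfun_scaler_closed.
HB.instance Definition _ := [SubZmodule_isSubLmodule of {sfun X >-> R} by <:].

Lemma sfunZ (k : R) (f : {sfun X >-> R}) x : (k *: f) x = k * f x.
Proof. by []. Qed.

End sfun_lmodule.

Section additive_tails.
Context d (X : measurableType d) (R : realType).

Definition disjoint_additive (f : set X -> R) :=
  forall A B, measurable A -> measurable B -> A `&` B = set0 ->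
    f (A `|` B) = f A + f B.

(** Tails replace the usual differences of partial unions: the union from [n] on
    splits off [F n], so that the partial sums telescope. *)
Lemma additive_tail (f : set X -> R) (F : (set X)^nat) n :
  disjoint_additive f -> (forall i, measurable (F i)) ->
  trivIset setT F ->
  \sum_(0 <= i < n) f (F i) = f (\bigcup_i F i) - f (\bigcup_i F (n + i)%N).
Proof.
move=> fD mF tF; elim: n => [|n IHn]; first by rewrite big_nil subrr.
rewrite big_nat_recr//= IHn.
suff -> : f (\bigcup_i F (n + i)%N) = f (F n) + f (\bigcup_i F (n.+1 + i)%N).
  by rewrite opprD addrA -addrA addrC; lra.
rewrite -fD//; last 2 first.
- exact: bigcup_measurable.
- apply/seteqP; split=> // x [Fnx [i _ Fix]].
  have : n = (n.+1 + i)%N by apply: tF => //; exists x.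
  by move=> /eqP; rewrite addSn -addnS -[X in X == _]addn0 eqn_add2l.
congr f; apply/seteqP; split=> [x [[|i] _ Fx]|x [Fnx|[i _ Fx]]].
- by left; rewrite addn0 in Fx.
- by right; exists i => //; rewrite addSnnS.
- by exists 0%N => //; rewrite addn0.
- by exists i.+1 => //; rewrite -addSnnS.
Qed.

(** An additive set function inherits countable additivity from a countably
    additive majorant, because its tails are squeezed to zero. *)
Lemma additive_dominated_cvg (f g : set X -> R) (F : (set X)^nat) :
  disjoint_additive f -> disjoint_additive g ->
  (forall A, measurable A -> 0 <= f A <= g A) ->
  (forall i, measurable (F i)) -> trivIset setT F ->
  (\sum_(0 <= i < n) g (F i)) @[n --> \oo] --> g (\bigcup_i F i) ->
  (\sum_(0 <= i < n) f (F i)) @[n --> \oo] --> f (\bigcup_i F i).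
Proof.
move=> fD gD fg mF tF gF.
have gt : g (\bigcup_i F (n + i)%N) @[n --> \oo] --> 0.
  rewrite (_ : (fun _ => _) =
      fun n => g (\bigcup_i F i) - \sum_(0 <= i < n) g (F i)); last first.
    by apply/funext => n; rewrite (additive_tail n gD mF tF) opprB addrC subrK.
  rewrite -[X in _ --> X](subrr (g (\bigcup_i F i))).
  by apply: cvgB => //; exact: cvg_cst.
have ft : f (\bigcup_i F (n + i)%N) @[n --> \oo] --> 0.
  apply: squeeze_cvgr _ gt; last exact: cvg_cst.
  by near=> n; apply: fg; apply: bigcup_measurable => k _.
under eq_fun do rewrite (additive_tail _ fD mF tF).
have := @cvgB _ _ _ _ _ (cst _) _ _ _ (cvg_cst (f (\bigcup_i F i))) ft.
by rewrite subr0; exact.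
Unshelve. all: by end_near. Qed.

End additive_tails.

Section density.
Context d (X : measurableType d) (R : realType).
Variables (mu : {finite_measure set X -> \bar R}).
Import HBSimple.

(** On the set where the inequality fails the two integrals agree over every
    measurable subset, so the functions are almost everywhere equal there. *)
Lemma le_ae_of_le_integral (f g : X -> \bar R) :
  mu.-integrable setT f -> mu.-integrable setT g ->
  (forall A, measurable A -> (\int[mu]_(x in A) f x <= \int[mu]_(x in A) g x)%E) ->
  {ae mu, forall x, (f x <= g x)%E}.
Proof.
move=> intf intg fg.
have mf := measurable_int _ intf; have mg := measurable_int _ intg.
pose A := [set x | (g x < f x)%E].
have mA : measurable A by rewrite -[A]setTI; exact: emeasurable_fun_lt.
have AT : A `<=` setT by [].
have : ae_eq mu A f g.
  apply: integral_ae_eq => //.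
  - exact: integrableS intf.
  - exact: measurable_funTS.
  - move=> E EA mE; apply/eqP; rewrite eq_le fg//=.
    apply: le_integral => //; [exact: integrableS intg|exact: integrableS intf|].
    by move=> x; rewrite inE => /EA /ltW.
apply: filterS => x Ax; rewrite leNgt; apply/negP => gf.
by move: (gf); rewrite Ax// ltxx.
Qed.

Variables (a b : X -> R) (L : {sfun X >-> R} -> R).
Hypotheses (ma : measurable_fun setT a) (mb : measurable_fun setT b).
Hypotheses (a0 : forall x, 0 <= a x) (ab : forall x, a x <= b x).
Hypothesis intb : mu.-integrable setT (EFin \o b).
Hypothesis linL : scalar L.
Hypothesis abL : forall A (mA : measurable A),
  (\int[mu]_(x in A) (a x)%:E <= (L (indic_sfun A mA))%:E <=
   \int[mu]_(x in A) (b x)%:E)%E.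

Let LD u v : L (u + v) = L u + L v.
Proof. by rewrite -[u]scale1r linL mul1r scale1r. Qed.

Let L0 : L 0 = 0.
Proof. by have := LD 0 0; rewrite addr0 => /eqP; rewrite -subr_eq subrr eq_sym => /eqP. Qed.

Let LZ c u : L (c *: u) = c * L u.
Proof. by rewrite -[c *: u]addr0 linL L0 addr0. Qed.

Let inta : mu.-integrable setT (EFin \o a).
Proof.
apply: le_integrable intb => //; first exact/measurable_EFinP.
by move=> x _ /=; rewrite lee_fin !ger0_norm// (le_trans (a0 x)).
Qed.

Let nu A : R :=
  if pselect (measurable A) is left mA then L (indic_sfun A mA) else 0.

Let nuE A (mA : measurable A) : nu A = L (indic_sfun A mA).
Proof.
by rewrite /nu; case: pselect => // mA'; congr L; apply/sfuneqP => x.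
Qed.

Let nuD : disjoint_additive nu.
Proof.
move=> A B mA mB AB0; rewrite (nuE mA) (nuE mB) (nuE (measurableU _ _ mA mB)) -LD.
congr L; apply/sfuneqP => x; rewrite sfunD/= /mindic !indicE in_setU.
have : x \notin A `&` B by rewrite AB0 in_set0.
by rewrite in_setI; case: (x \in A); case: (x \in B) => //=; rewrite ?addr0 ?add0r.
Qed.

Let Rint_fin f A : mu.-integrable setT (EFin \o f) -> measurable A ->
  (\int[mu]_(x in A) f x)%:E = (\int[mu]_(x in A) (f x)%:E)%E.
Proof.
move=> intf mA; rewrite /Rintegral fineK//.
by apply: integrable_fin_num => //; exact: integrableS intf.
Qed.

Let bD : disjoint_additive (fun A => \int[mu]_(x in A) b x).
Proof.
move=> A B mA mB AB0; rewrite Rintegral_setU//.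
  by apply: integrableS intb => //; exact: measurableU.
by apply/disj_setPS; rewrite AB0.
Qed.

Let nub A : measurable A -> 0 <= nu A <= \int[mu]_(x in A) b x.
Proof.
move=> mA; rewrite (nuE mA); have /andP[aL Lb] := abL mA.
rewrite -lee_fin; apply/andP; split.
  by apply: le_trans aL; apply: integral_ge0 => x _; rewrite lee_fin.
by rewrite -lee_fin Rint_fin.
Qed.

Let enu A : \bar R := (nu A)%:E.

Let enu0 : enu set0 = 0%E.
Proof.
rewrite /enu (nuE measurable0) (_ : indic_sfun _ _ = 0) ?L0//.
by apply/sfuneqP => x; rewrite /= /mindic indic0.
Qed.

Let enu_fin A : measurable A -> enu A \is a fin_num.
Proof. by []. Qed.

Let enu_sigma : semi_sigma_additive enu.
Proof.
move=> F mF tF mUF.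
under eq_fun do rewrite sumEFin.
apply: cvg_EFin; first exact: nearW.
rewrite (_ : fine \o _ = fun n => \sum_(0 <= i < n) nu (F i)); last by [].
apply: (additive_dominated_cvg nuD bD nub) => //.
have bE A : measurable A ->
    induced_charge intb A = (\int[mu]_(x in A) b x)%:E.
  by move=> mA; rewrite Rint_fin.
have : (\sum_(0 <= i < n) induced_charge intb (F i))%E @[n --> \oo] -->
    induced_charge intb (\bigcup_i F i).
  exact: charge_semi_sigma_additive.
rewrite bE//; under eq_fun.
  move=> n; under eq_bigr do rewrite bE//.
  rewrite sumEFin; over.
by move=> /fine_cvgP[].
Qed.

HB.instance Definition _ :=
  isCharge.Build _ _ _ enu enu0 enu_fin enu_sigma.

(** The set function [A |-> L 1_A] is additive and lies between the integrals of
    [a] and [b], which makes it a charge dominated by [mu]. Its Radon-Nikodym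
    derivative lies between [a] and [b] almost everywhere, and clipping makes
    this hold everywhere. Both sides of the integral formula are linear, so
    indicators suffice. *)
Theorem sfun_functional_density : exists q : X -> R,
  [/\ measurable_fun setT q, forall x, a x <= q x <= b x
    & forall w : {sfun X >-> R}, (L w)%:E = (\int[mu]_x (q x * w x)%:E)%E].
Proof.
have enu_mu : enu `<< mu.
  apply/null_content_dominatesP => A mA A0.
  have /andP[n0 nb] := nub mA; congr EFin; apply/eqP; rewrite eq_le n0 andbT.
  apply: le_trans nb _.
  rewrite /Rintegral null_set_integral//.
  by apply/measurable_EFinP; exact: measurable_funTS.
pose g := Radon_Nikodym enu mu.
have intg : mu.-integrable setT g by exact: Radon_Nikodym_integrable.
have nug A : measurable A -> enu A = (\int[mu]_(x in A) g x)%E.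
  by move=> mA; exact: Radon_Nikodym_integral.
have ag : {ae mu, forall x, ((a x)%:E <= g x)%E}.
  apply: le_ae_of_le_integral => // A mA.
  by rewrite -nug// /enu (nuE mA); case/andP: (abL mA).
have gb : {ae mu, forall x, (g x <= (b x)%:E)%E}.
  apply: le_ae_of_le_integral => // A mA.
  by rewrite -nug// /enu (nuE mA); case/andP: (abL mA).
pose q x := Num.min (Num.max (fine (g x)) (a x)) (b x).
have mg : measurable_fun setT g := measurable_int _ intg.
have mq : measurable_fun setT q.
  apply: measurable_minr => //; apply: measurable_maxr => //.
  exact: measurableT_comp.
have aqb x : a x <= q x <= b x.
  by rewrite /q ge_min lexx orbT andbT le_min ab le_max lexx orbT.
have gq : ae_eq mu setT g (EFin \o q).
  apply: filterS2 ag gb => x ax xb _ /=.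
  have gf : g x \is a fin_num.
    by rewrite fin_numElt (lt_le_trans _ ax) ?ltNyr// (le_lt_trans xb) ?ltry.
  move: ax xb; rewrite -(fineK gf) !lee_fin /q /= => ax xb.
  by rewrite (max_idPl ax) (min_idPl xb).
have intq : mu.-integrable setT (EFin \o q).
  apply: le_integrable intb => //; first exact/measurable_EFinP.
  move=> x _ /=; have /andP[h1 h2] := aqb x.
  by rewrite lee_fin !ger0_norm// (le_trans (a0 x))// (le_trans h1).
exists q; split => // w.
have nuq A : measurable A -> nu A = \int[mu]_(x in A) q x.
  move=> mA; apply: EFin_inj; rewrite Rint_fin// -[LHS]/(enu A) nug//.
  apply: ae_eq_integral => //; [exact: measurable_funTS| |].
    by apply: measurable_funTS; exact/measurable_EFinP.
  exact: ae_eq_subset gq.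
pose M (v : {sfun X >-> R}) := \int[mu]_x (q x * v x).
have intM (v : {sfun X >-> R}) : mu.-integrable setT (EFin \o (q \* v)).
  by apply: (integrableMl measurableT intq) => //; exact: simple_bounded.
have MD u v : M (u + v) = M u + M v.
  rewrite /M -RintegralD//; [|exact: intM..].
  by apply: eq_Rintegral => x _; rewrite -mulrDr.
have MZ c v : M (c *: v) = c * M v.
  rewrite /M -RintegralZl//; last exact: intM.
  by apply: eq_Rintegral => x _; rewrite mulrCA.
pose s := finmap.enum_fset (fset_set (range w)).
have mw y : measurable (w @^-1` [set y]) by exact: measurable_sfunP.
rewrite -(Rint_fin (intM w) measurableT) -/(M w); congr EFin.
have -> : w = \sum_(i < size s) s`_i *: indic_sfun _ (mw s`_i).
  by apply/sfuneqP => x; rewrite sfun_sum [LHS]fimfunEord.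
rewrite (big_morph L LD L0) (big_morph M MD (_ : M 0 = 0)); last first.
  by rewrite -(scale0r (0 : {sfun X >-> R})) MZ mul0r.
apply: eq_bigr => i _; rewrite LZ MZ -nuE nuq//; congr (_ * _).
rewrite Rintegral_mkcond; apply: eq_Rintegral => x _.
by rewrite /= patchE /mindic indicE; case: (x \in _); rewrite ?mulr1 ?mulr0.
Qed.

End density.

Local Open Scope ereal_scope.

(** * One-sided directional derivatives of a concave utility *)

Section directional_derivative.
Context {R : realType}.
Variable U : \bar R -> \bar R.
Hypotheses (concU : concave_nneg U) (ndU : nondecreasing_nneg U).
Hypothesis finU : finite_pos U.

(** The quotient under the limit in [dir_deriv]. *)
Definition diff_quot (x y : \bar R) (t : R) : \bar R :=
  (U ((1 - t)%:E * x + t%:E * y) - U x) * (t^-1)%:E.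

Lemma U_lty (x : R) : (0 <= x)%R -> U x%:E < +oo.
Proof.
move=> x0; apply: (@le_lt_trans _ _ (U (x + 1)%:E)); first by apply: ndU => //; lra.
by have := @finU (x + 1)%R; rewrite fin_numE -ltey => /(_ ltac:(lra)) /andP[].
Qed.

Lemma diff_quot_fine (r y t : R) :
  diff_quot r%:E y%:E t = (U ((1 - t) * r + t * y)%:E - U r%:E) * (t^-1)%:E.
Proof. by []. Qed.

Lemma diff_quot1 (r y : R) : diff_quot r%:E y%:E 1 = U y%:E - U r%:E.
Proof. by rewrite diff_quot_fine subrr mul0r add0r mul1r invr1 mule1. Qed.

Section finite_base.
Variable r : R.
Hypotheses (r0 : (0 <= r)%R) (Ur : U r%:E \is a fin_num).

(** The point at parameter [s] divides the segment from [r] to the point at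
    parameter [t] in the ratio [s / t]; concavity on that segment is the claim.
    The value of [U] at the far point may be [-oo]. *)
Lemma diff_quot_nonincreasing (y s t : R) : (0 <= y)%R -> (0 < s)%R ->
  (s <= t)%R -> (t <= 1)%R -> diff_quot r%:E y%:E t <= diff_quot r%:E y%:E s.
Proof.
move=> y0 s0 st t1; rewrite !diff_quot_fine.
have t0 : (0 < t)%R := lt_le_trans s0 st.
set z := ((1 - t) * r + t * y)%R.
have z0 : (0 <= z)%R by rewrite addr_ge0// mulr_ge0//; lra.
have th1 : (0 <= s / t <= 1)%R.
  by apply/andP; split; [rewrite divr_ge0// ltW|rewrite ler_pdivrMr// mul1r].
have := concU r0 z0 th1.
have -> : ((1 - s / t) * r + s / t * z = (1 - s) * r + s * y)%R.
  by rewrite /z; field; rewrite gt_eqF.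
have w0 : (0 <= (1 - s) * r + s * y)%R by rewrite addr_ge0// mulr_ge0//; lra.
move: Ur (U_lty z0) (U_lty w0).
case: (U r%:E) => // u _; case: (U z%:E) => //= [w|] _; last first.
  by rewrite addNye mulNyr gtr0_sg ?invr_gt0// mul1e leNye.
case: (U _) => // v _.
rewrite -!EFinB -!EFinM -!EFinD !lee_fin => h.
rewrite ler_pdivrMr// mulrAC ler_pdivlMr//.
have qt : (s / t * t = s)%R by rewrite divfK// gt_eqF.
have := ler_wpM2r (ltW t0) h.
have -> : (((1 - s / t) * u + s / t * w) * t = t * u + s / t * t * (w - u))%R.
  by ring.
by rewrite qt; lra.
Qed.

(** The quotients increase as the parameter decreases to 0, so their limit is their
    supremum. *)
Lemma dir_deriv_sup (y : R) : (0 <= y)%R ->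
  dir_deriv U r%:E y%:E = ereal_sup (diff_quot r%:E y%:E @` `]0%R, 1%R]).
Proof.
move=> y0; apply/cvg_lim => //.
apply: (nonincreasing_at_right_cvge (BRight 1%R)); first by rewrite bnd_simp.
move=> s t; rewrite !in_itv/= => /andP[s0 s1] /andP[t0 t1] st.
exact: diff_quot_nonincreasing.
Qed.

Lemma diff_quot_le_dir_deriv (y t : R) : (0 <= y)%R -> (0 < t <= 1)%R ->
  diff_quot r%:E y%:E t <= dir_deriv U r%:E y%:E.
Proof.
move=> y0 t01; rewrite dir_deriv_sup//; apply: ereal_sup_ubound.
by exists t => //=; rewrite in_itv.
Qed.

Lemma dir_deriv_le (y : R) (M : \bar R) : (0 <= y)%R ->
  (forall t, (0 < t <= 1)%R -> diff_quot r%:E y%:E t <= M) ->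
  dir_deriv U r%:E y%:E <= M.
Proof.
move=> y0 h; rewrite dir_deriv_sup//; apply: ge_ereal_sup => _ [t + <-].
by rewrite /= in_itv/=; exact: h.
Qed.

Lemma sub_le_dir_deriv (y : R) : (0 <= y)%R ->
  U y%:E - U r%:E <= dir_deriv U r%:E y%:E.
Proof.
by move=> y0; rewrite -diff_quot1; apply: diff_quot_le_dir_deriv => //; rewrite ltr01 lexx.
Qed.

(** Moving with parameter [t] towards [r + c (y - r)] is moving with parameter
    [c t] towards [y]. *)
Let dir_derivZ_le (y c : R) : (0 <= y)%R -> (0 < c)%R ->
  (0 <= r + c * (y - r))%R ->
  dir_deriv U r%:E (r + c * (y - r))%:E <= c%:E * dir_deriv U r%:E y%:E.
Proof.
move=> y0 c0 z0; apply: dir_deriv_le => // t /andP[t0 t1].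
(* c t may exceed 1, so t is first decreased *)
pose s := Num.min t (c^-1)%R.
have s0 : (0 < s)%R by rewrite lt_min t0 invr_gt0.
have st : (s <= t)%R by rewrite ge_min lexx.
have cs1 : (c * s <= 1)%R.
  by rewrite -(divff (lt0r_neq0 c0)) ler_pM2l// ge_min lexx orbT.
have cs0 : (0 < c * s)%R by rewrite mulr_gt0.
apply: le_trans (diff_quot_nonincreasing z0 s0 st t1) _.
have -> : diff_quot r%:E (r + c * (y - r))%:E s =
    c%:E * diff_quot r%:E y%:E (c * s)%R.
  rewrite !diff_quot_fine muleCA -EFinM invfM mulVKf ?gt_eqF//.
  by congr (((U _%:E) - _) * _); ring.
by rewrite lee_pmul2l//; apply: diff_quot_le_dir_deriv => //; rewrite cs0 cs1.
Qed.

Lemma dir_derivZ (y c : R) : (0 <= y)%R -> (0 < c)%R ->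
  (0 <= r + c * (y - r))%R ->
  dir_deriv U r%:E (r + c * (y - r))%:E = c%:E * dir_deriv U r%:E y%:E.
Proof.
move=> y0 c0 z0; apply/eqP; rewrite eq_le dir_derivZ_le//=.
set z := (r + _)%R in z0 *.
have yE : (y = r + c^-1 * (z - r))%R by rewrite /z; field; rewrite gt_eqF.
have ci0 : (0 < c^-1)%R by rewrite invr_gt0.
have := @dir_derivZ_le z c^-1 z0 ci0; rewrite -yE => /(_ y0).
rewrite -(@lee_pmul2l _ c%:E)// muleA -EFinM divff ?gt_eqF// mul1e; exact.
Qed.

Lemma dir_deriv_ge0 (y : R) : (r <= y)%R -> 0 <= dir_deriv U r%:E y%:E.
Proof.
move=> ry; apply: le_trans (sub_le_dir_deriv (le_trans r0 ry)).
by rewrite sube_ge0 ?ndU// Ur.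
Qed.

Lemma dir_deriv_le0 (y : R) : (0 <= y)%R -> (y <= r)%R ->
  dir_deriv U r%:E y%:E <= 0.
Proof.
move=> y0 yr; apply: dir_deriv_le => // t /andP[t0 t1].
rewrite diff_quot_fine; apply: mule_le0_ge0; last by rewrite lee_fin invr_ge0 ltW.
rewrite sube_le0 ?Ur//.
apply: ndU; first by rewrite addr_ge0// mulr_ge0//; lra.
by nra.
Qed.

Lemma dir_derivxx : dir_deriv U r%:E r%:E = 0.
Proof. by apply/eqP; rewrite eq_le dir_deriv_le0 ?dir_deriv_ge0. Qed.

Lemma dir_deriv0_fin : dir_deriv U r%:E 0%:E \is a fin_num.
Proof.
move: r0; rewrite le_eqVlt => /predU1P[rE|r1].
  by have := dir_derivxx; rewrite -{2}rE => ->.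
rewrite fin_numElt (le_lt_trans (dir_deriv_le0 (lexx _) r0)) ?ltry// andbT.
apply: lt_le_trans (@diff_quot_le_dir_deriv 0 2^-1 (lexx _) _); last first.
  by rewrite invr_gt0 ltr0n/= invf_le1// ler1n.
have p0 : (0 < (1 - 2^-1) * r + 2^-1 * 0)%R by lra.
rewrite diff_quot_fine -(fineK (finU p0)) -(fineK Ur) -EFinB -EFinM.
exact: ltNyr.
Qed.

(** The right derivative is at most the left derivative, both multiplied by [r]:
    [r] is the midpoint of [r - m r] and [r + m r]. *)
Lemma dir_deriv_opposite :
  dir_deriv U r%:E (2 * r)%:E <= - dir_deriv U r%:E 0%:E.
Proof.
have r20 : (0 <= 2 * r)%R by rewrite mulr_ge0.
apply: dir_deriv_le => // t /andP[t0 t1]; rewrite leeNr.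
apply: dir_deriv_le => // s /andP[s0 s1].
pose m := Num.min s t.
have m0 : (0 < m)%R by rewrite lt_min s0.
have ms : (m <= s)%R by rewrite ge_min lexx.
have mt : (m <= t)%R by rewrite ge_min lexx orbT.
apply: le_trans (diff_quot_nonincreasing (lexx _) m0 ms s1) _.
apply: (@le_trans _ _ (- diff_quot r%:E (2 * r)%:E m)); last first.
  by rewrite leeN2; exact: diff_quot_nonincreasing.
rewrite !diff_quot_fine.
have p0 : (0 <= (1 - m) * r + m * 0)%R by rewrite mulr0 addr0 mulr_ge0//; move: r0; lra.
have q0 : (0 <= (1 - m) * r + m * (2 * r))%R by move: r0; nra.
have h01 : (0 <= (2^-1 : R) <= 1)%R by lra.
have := concU p0 q0 h01.
have -> : ((1 - 2^-1) * ((1 - m) * r + m * 0) +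
           2^-1 * ((1 - m) * r + m * (2 * r)) = r)%R by field.
have Uq : U r%:E <= U ((1 - m) * r + m * (2 * r))%:E by apply: ndU; move: r0 => //; nra.
move: Ur (U_lty p0) (U_lty q0) Uq.
case: (U r%:E) => // u _; case: (U _%:E) => //= [v|] _; last first.
  by rewrite addNye mulNyr gtr0_sg ?invr_gt0// mul1e leNye.
case: (U _) => // w _ _.
rewrite -!EFinB -!EFinM -!EFinD -EFinN !lee_fin => h.
by rewrite -mulNr ler_pM2r ?invr_gt0//; lra.
Qed.

(** [a] and [b] are [r] times the right and the left derivative of [U] at [r];
    both vanish when [r = 0]. *)
Let a := fine (dir_deriv U r%:E (2 * r)%:E).
Let b := (- fine (dir_deriv U r%:E 0%:E))%R.

Lemma dir_deriv2_fin : dir_deriv U r%:E (2 * r)%:E \is a fin_num.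
Proof.
rewrite fin_numElt (lt_le_trans _ (dir_deriv_ge0 _)) ?ltNyr//=; last by move: r0; lra.
apply: le_lt_trans dir_deriv_opposite _.
by rewrite -(fineK dir_deriv0_fin) -EFinN ltry.
Qed.

Lemma slopes_bounds : (0 <= a <= b)%R.
Proof.
apply/andP; split; first by apply/fine_ge0/dir_deriv_ge0; move: r0; lra.
rewrite -lee_fin /a /b EFinN !fineK ?dir_deriv2_fin ?dir_deriv0_fin//.
exact: dir_deriv_opposite.
Qed.

(** Homogeneity reduces every direction to the targets [2 r] and [0]; as
    [a <= b], the two cases are one maximum, which is sublinear in [1 - w]. *)
Lemma dir_deriv_scaled (w : R) : (0 <= w)%R ->
  dir_deriv U r%:E (r * w)%:E =
  (- Num.max (a * (1 - w)) (b * (1 - w)))%:E.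
Proof.
move=> w0; have /andP[a0 ab] := slopes_bounds.
have [w1|w1|->] := ltgtP w 1%R; last 1 first.
- by rewrite subrr !mulr0 maxxx oppr0 mulr1 dir_derivxx.
- have z0 : (0 <= r + (1 - w) * (0 - r))%R by move: r0; nra.
  have -> : (r * w = r + (1 - w) * (0 - r))%R by ring.
  rewrite dir_derivZ//; last lra.
  rewrite -(fineK dir_deriv0_fin) -EFinM; congr EFin.
  rewrite (max_idPr _); last by rewrite ler_pM2r//; lra.
  by rewrite /b; ring.
- have z0 : (0 <= r + (w - 1) * (2 * r - r))%R by move: r0; nra.
  have -> : (r * w = r + (w - 1) * (2 * r - r))%R by ring.
  rewrite dir_derivZ//; [|move: r0; lra..].
  rewrite -(fineK dir_deriv2_fin) -EFinM; congr EFin.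
  rewrite (max_idPl _); last by rewrite ler_nM2r//; lra.
  by rewrite -/a; ring.
Qed.

End finite_base.

Lemma dir_deriv_at0 (y : R) : U 0%:E \is a fin_num -> (0 <= y)%R ->
  dir_deriv U 0%:E y%:E = y%:E * dir_deriv U 0%:E 1%:E.
Proof.
move=> U0; rewrite le_eqVlt => /predU1P[<-|y0].
  by rewrite dir_derivxx// mul0e.
rewrite -dir_derivZ//; first by rewrite subr0 mulr1 add0r.
by rewrite subr0 mulr1 add0r ltW.
Qed.

(** The limit exists for all nonnegative extended arguments, also where the
    difference quotient is not monotone or where [U] is infinite; it is used to
    obtain measurability at every point and not only almost everywhere. *)
Lemma is_cvg_diff_quot (x y : \bar R) : 0 <= x -> 0 <= y ->
  cvg (diff_quot x y t @[t --> (0%R : R)^'+]).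
Proof.
have near01 : \forall t \near (0%R : R)^'+, (0 < t < 1)%R.
  near=> t; apply/andP; split; near: t; [exact: nbhs_right_gt|].
  by apply: nbhs_right_lt.
have key (c : \bar R) : (forall t : R, (0 < t < 1)%R -> diff_quot x y t = c) ->
    cvg (diff_quot x y t @[t --> (0%R : R)^'+]).
  move=> h; apply/cvg_ex; exists c; apply: cvg_near_cst.
  by near do apply: h.
have gen (c : \bar R) : (forall t : R, (0 < t < 1)%R ->
    diff_quot x y t = c * (t^-1)%:E) ->
    cvg (diff_quot x y t @[t --> (0%R : R)^'+]).
  move=> h.
  have [c0|c0] := leP 0 c.
    apply: nonincreasing_at_right_is_cvge; near=> e => s t.
    have e1 : (e < 1)%R by near: e; exact: nbhs_right_lt.
    rewrite !in_itv/= => /andP[s0 se] /andP[t0 te] st.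
    rewrite !h ?s0 ?t0 ?(lt_trans se) ?(lt_trans te)//.
    by rewrite lee_wpmul2l// lee_fin lef_pV2.
  apply: nondecreasing_at_right_is_cvge; near=> e => s t.
  have e1 : (e < 1)%R by near: e; exact: nbhs_right_lt.
  rewrite !in_itv/= => /andP[s0 se] /andP[t0 te] st.
  rewrite !h ?s0 ?t0 ?(lt_trans se) ?(lt_trans te)//.
  rewrite -leeN2 -!mulNe lee_wpmul2l ?oppe_ge0 ?(ltW c0)//.
  by rewrite lee_fin lef_pV2.
case: x key gen => [r| |] key gen // r0; last first.
- move=> y0; apply: (gen (U +oo - U +oo)) => t /andP[t0 t1].
  rewrite /diff_quot mulry gtr0_sg ?subr_gt0// mul1e addye//.
  by rewrite gt_eqF// (lt_le_trans (ltNyr 0))// mule_ge0// lee_fin ltW.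
- case: y key gen => [y| |] key gen // y0; last first.
    apply: (gen (U +oo - U r%:E)) => t /andP[t0 t1].
    by rewrite /diff_quot mulry gtr0_sg// mul1e addey// -EFinM.
  have [Ur|Ur] := boolP (U r%:E \is a fin_num).
    apply: nonincreasing_at_right_is_cvge; near=> e => s t.
    have e1 : (e < 1)%R by near: e; exact: nbhs_right_lt.
    rewrite !in_itv/= => /andP[s0 se] /andP[t0 te] st.
    by apply: diff_quot_nonincreasing => //; rewrite ltW// (lt_trans te).
  move: r0; rewrite lee_fin le_eqVlt => /predU1P[rE|r0]; last first.
    by rewrite finU in Ur.
  have UN : U r%:E = -oo.
    have r0 : (0 <= r)%R by rewrite -rE.
    by move: Ur (U_lty r0); case: (U r%:E).
  rewrite lee_fin in y0; move: y0; rewrite le_eqVlt => /predU1P[yE|y0].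
    apply: (gen -oo) => t /andP[t0 t1].
    by rewrite diff_quot_fine -yE -rE !mulr0 addr0 {1}rE UN.
  apply: (gen +oo) => t /andP[t0 t1].
  rewrite diff_quot_fine UN /=.
  have : (0 < (1 - t) * r + t * y)%R by rewrite -rE mulr0 add0r mulr_gt0.
  by move=> /finU; case: (U _).
Unshelve. all: by end_near. Qed.

Lemma cvg_diff_quot (x y : \bar R) : 0 <= x -> 0 <= y ->
  diff_quot x y t @[t --> (0%R : R)^'+] --> dir_deriv U x y.
Proof. exact: is_cvg_diff_quot. Qed.

Lemma cvg_diff_quot_seq (x y : \bar R) (t_ : R^nat) : 0 <= x -> 0 <= y ->
  (forall n, 0 < t_ n)%R -> t_ n @[n --> \oo] --> (0:R)%R ->
  diff_quot x y (t_ n) @[n --> \oo] --> dir_deriv U x y.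
Proof.
move=> x0 y0 tp t0; apply: cvg_comp (cvg_diff_quot x0 y0).
move=> A /t0[N _ NA]; exists N => // n Nn; apply: NA => //; exact: tp.
Qed.

End directional_derivative.

(** * The integrable first-order condition *)

Section conull.
Context d (X : measurableType d) (R : realType) (mu : {measure set X -> \bar R}).
Variable G : set X.
Hypotheses (mG : measurable G) (G0 : mu (~` G) = 0).

Lemma integral_conull f : measurable_fun setT f ->
  \int[mu]_x f x = \int[mu]_(x in G) f x.
Proof.
move=> mf; have mCG := measurableC mG.
have GE : [set: X] `\` ~` G = G by rewrite setDE setCK setTI.
rewrite integralE [RHS]integralE.
by rewrite !(ge0_negligible_integral mCG measurableT)// ?GE//;
  [exact: measurable_funeneg|exact: measurable_funepos].
Qed.

Lemma integrable_conull f : measurable_fun setT f ->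
  mu.-integrable G f -> mu.-integrable setT f.
Proof.
move=> mf intf; have mCG := measurableC mG.
apply/(negligible_integrable mCG) => //.
by rewrite setDE setCK setTI.
Qed.

Lemma ae_conull : {ae mu, forall x, G x}.
Proof. by exists (~` G); split=> //; exact: measurableC. Qed.

End conull.

Section monotone_limit.
Context d (X : measurableType d) (R : realType) (mu : {measure set X -> \bar R}).

(** Monotone convergence for [h n + K], which is nonnegative; subtracting the
    integrable [K] turns the bound on the integrals of [h n] into one for the
    limit, and the lower bound [- K] gives integrability. *)
Lemma monotone_limit_integrable (G : set X) (h : (X -> \bar R)^nat)
    (D K : X -> \bar R) : measurable G ->
  measurable_fun G D -> mu.-integrable G K ->
  (forall x, G x -> K x \is a fin_num) ->
  (forall n x, G x -> - K x <= h n x) ->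
  (forall n, mu.-integrable G (h n)) ->
  (forall n, \int[mu]_(x in G) h n x <= 0) ->
  (forall x, G x -> {homo h^~ x : n m / (n <= m)%N >-> n <= m}) ->
  (forall x, G x -> h n x @[n --> \oo] --> D x) ->
  mu.-integrable G D /\ \int[mu]_(x in G) D x <= 0.
Proof.
move=> mG mD intK Kfin Kh inth h0 hnd hD.
have mK := measurable_int _ intK.
have mh n := measurable_int _ (inth n).
have DK x : G x -> h n x + K x @[n --> \oo] --> D x + K x.
  move=> Gx; apply: cvgeD; [|exact: hD|exact: cvg_cst].
  by rewrite fin_num_adde_defl// Kfin.
have hK0 n x : G x -> 0 <= h n x + K x.
  by move=> Gx; rewrite -leeBlDr ?Kfin// sub0e Kh.
have hKnd x : G x -> {homo (fun n => h n x + K x) : n m / (n <= m)%N >-> n <= m}.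
  by move=> Gx n m nm; rewrite leeD2r// hnd.
have mhK n : measurable_fun G (fun x => h n x + K x) by exact: emeasurable_funD.
have DK0 x : G x -> 0 <= D x + K x.
  by move=> Gx; apply: (cvge_ge _ (DK _ Gx)); apply: nearW => n; exact: hK0.
have le : \int[mu]_(x in G) (D x + K x) <= \int[mu]_(x in G) K x.
  have -> : \int[mu]_(x in G) (D x + K x) =
      \int[mu]_(x in G) limn (fun n => h n x + K x).
    by apply: eq_integral => x; rewrite inE => Gx; apply/esym/cvg_lim => //; exact: DK.
  rewrite monotone_convergence//; apply: lime_le.
    apply: ereal_nondecreasing_is_cvgn => n m nm.
    by apply: ge0_le_integral => // x Gx; [exact: hK0|exact: hKnd].
  apply: nearW => n; rewrite integralD//.
  by rewrite -[leRHS]add0e leeD2r.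
have intDK : mu.-integrable G (D \+ K).
  apply/integrableP; split; first exact: emeasurable_funD.
  apply: le_lt_trans (integrable_lty mG intK).
  apply: le_trans le; rewrite le_eqVlt; apply/orP; left; apply/eqP.
  by apply: eq_integral => x; rewrite inE => Gx; rewrite gee0_abs// DK0.
have DE : {in G, (D \+ K) \- K =1 D}.
  by move=> x; rewrite inE => Gx /=; rewrite addeK// Kfin.
have intD : mu.-integrable G D.
  by apply: eq_integrable DE _ => //; exact: integrableB.
split=> //; rewrite -(eq_integral _ _ DE) integralB//.
by rewrite sube_le0 ?integrable_fin_num.
Qed.

(** The positive part is at most [K]; the integral would be [-oo] if that of the
    negative part were infinite. *)
Lemma integrable_upper_bounded (G : set X) (f K : X -> \bar R) :
  measurable G -> measurable_fun G f -> mu.-integrable G K ->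
  (forall x, G x -> f x <= K x) -> (forall x, G x -> 0 <= K x) ->
  -oo < \int[mu]_(x in G) f x ->
  mu.-integrable G f.
Proof.
move=> mG mf intK fK K0.
have fp : \int[mu]_(x in G) f^\+ x < +oo.
  apply: le_lt_trans (integrable_lty mG intK); apply: ge0_le_integral => //.
  - exact: measurable_funepos.
  - exact: measurable_int intK.
  - by move=> x Gx; rewrite funeposE ge_max fK//= K0.
rewrite integralE => fN.
have fn : \int[mu]_(x in G) f^\- x < +oo.
  rewrite ltey; apply: contraTneq fN => ->.
  by rewrite addeNy.
apply/integrableP; split=> //.
rewrite (_ : \int[mu]_(x in G) _ = \int[mu]_(x in G) (f^\+ x + f^\- x)); last first.
  by apply: eq_integral => x _; rewrite -[LHS]/((abse \o f) x) fune_abse.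
rewrite ge0_integralD//; [|exact: measurable_funepos|exact: measurable_funeneg].
by rewrite lte_add_pinfty.
Qed.

End monotone_limit.

Section first_order.
Context d (X : measurableType d) (R : realType).
Variables (H : set (probability X R)) (Qa : {finite_measure set X -> \bar R}).
Variables (U : \bar R -> \bar R) (es : X -> \bar R).
Hypothesis Qa_negl : forall A, hyp_negligible H A -> Qa A = 0.
Hypothesis mU : measurable_fun [set z : \bar R | 0 <= z] U.
Hypotheses (concU : concave_nneg U) (ndU : nondecreasing_nneg U).
Hypothesis finU : finite_pos U.

(** A finite expectation forces almost sure finiteness under each hypothesis, so the
    exceptional event is [H]-negligible. *)
Lemma evalue_fin (e : X -> \bar R) : measurable_fun setT e ->
  (forall x, 0 <= e x) -> (forall P, H P -> \int[P]_x e x < +oo) ->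
  Qa (~` [set x | e x \is a fin_num]) = 0.
Proof.
move=> me e0 eoo.
have mF : measurable [set x | e x \is a fin_num].
  by rewrite -[X in measurable X]setTI; exact: emeasurable_fin_num.
apply: Qa_negl; split; first exact: measurableC.
move=> P HP; apply: measure_negligible; first exact: measurableC.
have inte : P.-integrable setT e.
  by apply/integrableP; split=> //; under eq_integral do rewrite gee0_abs//; exact: eoo.
by have := integrable_ae measurableT inte; apply: filterS => x; exact.
Qed.

Lemma measurable_utility (e : X -> \bar R) : measurable_fun setT e ->
  (forall x, 0 <= e x) -> measurable_fun setT (U \o e).
Proof.
move=> me e0; apply: (@measurable_comp _ _ _ _ _ _ [set z | 0 <= z]) => //.
  by rewrite -[X in measurable X]setTI; exact: emeasurable_fun_c_infty.
by move=> _ [x _ <-]; exact: e0.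
Qed.

Let mix (t : R) (e f : X -> \bar R) x := (1 - t)%:E * e x + t%:E * f x.

Lemma measurable_mix t e f : measurable_fun setT e -> measurable_fun setT f ->
  measurable_fun setT (mix t e f).
Proof.
by move=> me mf; apply: emeasurable_funD; exact: measurable_funeM.
Qed.

Lemma mix_ge0 t e f x : (0 <= t <= 1)%R -> 0 <= e x -> 0 <= f x ->
  0 <= mix t e f x.
Proof.
move=> /andP[t0 t1] e0 f0.
by rewrite adde_ge0// mule_ge0// lee_fin// subr_ge0.
Qed.

Lemma measurable_dir_deriv (e f : X -> \bar R) :
  measurable_fun setT e -> (forall x, 0 <= e x) ->
  measurable_fun setT f -> (forall x, 0 <= f x) ->
  measurable_fun setT (fun x => dir_deriv U (e x) (f x)).
Proof.
move=> me e0 mf f0.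
pose t_ n : R := (n.+1%:R^-1)%R.
apply: (emeasurable_fun_cvg (fun n x => diff_quot U (e x) (f x) (t_ n))).
  move=> n; rewrite /diff_quot; under eq_fun do rewrite muleC.
  apply: measurable_funeM; apply: emeasurable_funB; last exact: measurable_utility.
  apply: (@measurable_utility (mix (t_ n) e f)); first exact: measurable_mix.
  by move=> x; apply: mix_ge0; rewrite // /t_ invr_ge0 ler0n/= invf_le1// ler1n.
move=> x _; apply: cvg_diff_quot_seq => //.
  by move=> n; rewrite /t_ invr_gt0 ltr0n.
exact: cvg_harmonic.
Qed.

Lemma evalue_mix t e f : (0 <= t <= 1)%R -> evalue H e -> evalue H f ->
  evalue H (mix t e f).
Proof.
move=> t01 [me e0 eP] [mf f0 fP]; split; first exact: measurable_mix.
  by move=> x; exact: mix_ge0.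
case/andP: t01 => t0 t1 P HP.
rewrite /mix ge0_integralD//=; last 4 first.
- by move=> x _; rewrite mule_ge0// lee_fin subr_ge0.
- exact: measurable_funeM.
- by move=> x _; rewrite mule_ge0.
- exact: measurable_funeM.
rewrite !ge0_integralZl_EFin// ?subr_ge0//.
apply: (@le_trans _ _ ((1 - t)%:E * 1 + t%:E * 1)).
  by apply: leeD; apply: lee_wpmul2l; rewrite ?lee_fin ?subr_ge0// ?eP ?fP.
by rewrite !mule1 -EFinD subrK.
Qed.

Hypothesis es_opt : U_optimal H Qa U es.

(** Optimality includes that [U es - U es] is well-defined almost everywhere, which
    excludes [+oo - +oo] and [-oo - -oo]. *)
Lemma utility_optimum_fin : Qa (~` [set x | U (es x) \is a fin_num]) = 0.
Proof.
have [es_ev opt] := es_opt; have [[ae_def _] _] := opt _ es_ev.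
have [mes es0 _] := es_ev.
have mF : measurable [set x | U (es x) \is a fin_num].
  rewrite -[X in measurable X]setTI; apply: emeasurable_fin_num => //.
  exact: measurable_utility.
apply: measure_negligible; first exact: measurableC.
by apply: filterS ae_def => x /=; case: (U (es x)).
Qed.

Hypothesis es_scale : exists a : R, (0 < a < 1)%R /\
  \int[Qa]_x (U (es x) - U (a%:E * es x)) < +oo.

(** The difference quotients towards [e] have nonpositive integrals since the
    mixtures are e-values. They increase as the parameter decreases. A mixture
    of parameter at most [1 - a] is at least [a * es], so the first quotient is
    at least [(U (a es) - U es) / (1 - a)], the integrable minorant needed for
    monotone convergence. *)
Lemma optimum_first_order : integrable_first_order H Qa U es.
Proof.
move=> e e_ev; have [a [/andP[a0 a1] kfin]] := es_scale.
have [es_ev opt] := es_opt.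
have [mes es0 esP] := es_ev; have [me e0 eP] := e_ev.
pose G := [set x | es x \is a fin_num] `&` [set x | e x \is a fin_num]
  `&` [set x | U (es x) \is a fin_num].
have mfin f : measurable_fun setT f -> measurable [set x : X | f x \is a fin_num].
  by move=> mf; rewrite -[X in measurable X]setTI; exact: emeasurable_fin_num.
have mUes := measurable_utility mes es0.
have mG : measurable G by apply: measurableI; [apply: measurableI|]; exact: mfin.
have G0 : Qa (~` G) = 0.
  apply: measure_negligible; first exact: measurableC.
  rewrite !setCI; apply: negligibleU; first apply: negligibleU.
  - apply/negligibleP; first by apply: measurableC; exact: mfin.
    by apply: evalue_fin => // P HP; rewrite (le_lt_trans (esP _ HP)) ?ltry.
  - apply/negligibleP; first by apply: measurableC; exact: mfin.
    by apply: evalue_fin => // P HP; rewrite (le_lt_trans (eP _ HP)) ?ltry.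
  - apply/negligibleP; first by apply: measurableC; exact: mfin.
    exact: utility_optimum_fin.
have fines x : G x -> exists2 r, es x = r%:E & (0 <= r)%R.
  move=> [[/= esf _] _]; exists (fine (es x)); first by rewrite fineK.
  exact: fine_ge0.
have finee x : G x -> exists2 r, e x = r%:E & (0 <= r)%R.
  move=> [[/= _ ef] _]; exists (fine (e x)); first by rewrite fineK.
  exact: fine_ge0.
have a1' : (0 < 1 - a)%R by rewrite subr_gt0.
pose t_ n := ((1 - a) / n.+1%:R)%R.
have t_gt0 n : (0 < t_ n)%R by rewrite divr_gt0.
have t_le n : (t_ n <= 1 - a)%R.
  by rewrite ler_pdivrMr// ler_peMr// ?ler1n// ltW.
have t01 n : (0 <= t_ n <= 1)%R 
  by have := t_gt0 n; have := t_le n; lra.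
have t_cvg : t_ n @[n --> \oo] --> (0 : R)%R.
  rewrite -[X in _ --> X](mulr0 (1 - a)%R).
  by apply: cvgM; [exact: cvg_cst|exact: cvg_harmonic].
have aesE x r : es x = r%:E -> a%:E * es x = (a * r)%:E by move=> ->.
pose k x := U (es x) - U (a%:E * es x).
have k_fin x : G x -> U (a%:E * es x) \is a fin_num.
  move=> Gx; have [r rE r0] := fines _ Gx; rewrite (aesE _ _ rE).
  move: r0; rewrite le_eqVlt => /predU1P[r00|r0].
    by case: Gx => _ /=; rewrite rE -r00 mulr0.
  by apply: finU; rewrite mulr_gt0.
have k_ge0 x : G x -> 0 <= k x.
  move=> Gx; have [r rE r0] := fines _ Gx.
  rewrite sube_ge0; last by rewrite k_fin.
  rewrite (aesE _ _ rE) rE; apply: ndU; first by rewrite mulr_ge0// ltW.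
  by rewrite ler_piMl// ltW.
have mk : measurable_fun setT k.
  apply: emeasurable_funB => //.
  apply: (@measurable_utility (fun x => a%:E * es x)); first exact: measurable_funeM.
  by move=> x; rewrite mule_ge0// lee_fin ltW.
have intk : Qa.-integrable G k.
  apply/integrableP; split; first exact: measurable_funTS.
  rewrite (_ : \int[Qa]_(x in G) _ = \int[Qa]_(x in G) k x); last first.
    by apply: eq_integral => x; rewrite inE => Gx; rewrite gee0_abs// k_ge0.
  by rewrite -(integral_conull mG G0 mk).
pose K x := ((1 - a)^-1)%:E * k x.
have intK : Qa.-integrable G K by exact: integrableZl.
pose h n x := diff_quot U (es x) (e x) (t_ n).
pose g n x := U (es x) - U (mix (t_ n) es e x).
have mixE n x r y : es x = r%:E -> e x = y%:E ->
    mix (t_ n) es e x = ((1 - t_ n) * r + t_ n * y)%:E.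
  by move=> rE yE; rewrite /mix rE yE.
have g_le n x : G x -> g n x \is a fin_num /\ g n x <= k x.
  move=> Gx; have [r rE r0] := fines _ Gx; have [y yE y0] := finee _ Gx.
  have le1 : U (a%:E * es x) <= U (mix (t_ n) es e x).
    rewrite (mixE _ _ _ _ rE yE) (aesE _ _ rE).
    apply: ndU; first by rewrite mulr_ge0// ltW.
    have := t_le n; have := t_gt0 n; nra.
  have mfin' : U (mix (t_ n) es e x) \is a fin_num.
    rewrite fin_numElt (lt_le_trans _ le1)/=; last first.
      by move: (k_fin _ Gx); rewrite fin_numElt => /andP[].
    rewrite (mixE _ _ _ _ rE yE); apply: U_lty => //.
    by have := t01 n; move=> /andP[]; nra.
  split; last by rewrite /g /k leeB.
  by rewrite fin_numB mfin' andbT; case: Gx.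
have g_opt n : Qa.-integrable G (g n) /\ 0 <= \int[Qa]_(x in G) g n x.
  have mg : measurable_fun setT (g n).
    apply: emeasurable_funB => //.
    apply: measurable_utility; first exact: measurable_mix.
    by move=> x; exact: mix_ge0.
  have [_] := opt _ (evalue_mix (t01 n) es_ev e_ev).
  rewrite (integral_conull mG G0 mg) => g0; split=> //.
  apply: (integrable_upper_bounded mG _ intk) => //.
  - exact: measurable_funTS.
  - by move=> x /(g_le n)[].
  - by rewrite (lt_le_trans _ g0).
have hg n x : G x -> h n x = (- (t_ n)^-1)%:E * g n x.
  move=> Gx; have [gf _] := g_le n _ Gx.
  rewrite EFinN mulNe muleC -mulNe /h /diff_quot -/(mix (t_ n) es e x) /g.
  have Uesf : U (es x) \is a fin_num by case: Gx.
  by rewrite oppeB ?fin_num_adde_defr// [in RHS]addeC.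
have hnd x : G x -> {homo h^~ x : n m / (n <= m)%N >-> n <= m}.
  move=> Gx n m nm; have [r rE r0] := fines _ Gx; have [y yE y0] := finee _ Gx.
  rewrite /h rE yE; apply: diff_quot_nonincreasing => //.
  - by case: Gx => _; rewrite /= rE.
  - by rewrite ler_pM2l// lef_pV2 ?posrE ?ltr0n// ler_nat.
  - by have /andP[] := t01 n.
have mD := measurable_dir_deriv mes es0 me e0.
have intD : Qa.-integrable G (fun x => dir_deriv U (es x) (e x)) /\
    \int[Qa]_(x in G) dir_deriv U (es x) (e x) <= 0.
  apply: (@monotone_limit_integrable _ _ _ _ G h _ K) => //.
  - exact: measurable_funTS.
  - move=> x Gx; rewrite fin_numM// fin_numB k_fin//.
    by case: Gx => _ ->.
  - move=> n x Gx; apply: le_trans (hnd _ Gx _ _ (leq0n n)).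
    rewrite hg// EFinN mulNe leeN2 /t_ divr1 lee_wpmul2l//.
      by rewrite lee_fin invr_ge0 ltW.
    by have [_] := g_le 0%N _ Gx.
  - move=> n; have [intg _] := g_opt n.
    apply: eq_integrable (integrableZl _ (- (t_ n)^-1)%R intg) => // x.
    by rewrite inE => Gx; rewrite hg.
  - move=> n; have [intg g0] := g_opt n.
    rewrite (_ : \int[Qa]_(x in G) _ =
        \int[Qa]_(x in G) ((- (t_ n)^-1)%:E * g n x)); last first.
      by apply: eq_integral => x; rewrite inE => Gx; rewrite hg.
    rewrite integralZl// mule_le0_ge0// lee_fin oppr_le0 invr_ge0.
    by have /andP[] := t01 n.
  - move=> x Gx; exact: cvg_diff_quot_seq.
split; first by apply: (integrable_conull mG G0 mD); case: intD.
by rewrite (integral_conull mG G0 mD); case: intD.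
Qed.

End first_order.

(** * Measures with a density *)

Lemma measurable_inv (R : realType) : measurable_fun setT (@GRing.inv R).
Proof.
rewrite -(setUv [set 0%R]); apply/measurable_funU => //; first exact: measurableC.
split; first exact: measurable_fun_set1.
apply: open_continuous_measurable_fun; first exact: closed_openC.
by move=> x; rewrite inE => /eqP x0; exact: inv_continuous.
Qed.

Section density_measure.
Context d (X : measurableType d) (R : realType).
Variable mu : {finite_measure set X -> \bar R}.

(** Almost everywhere uniqueness of densities identifies the chosen version of the
    Radon-Nikodym derivative with [f]. *)
Lemma measure_with_density (f : X -> \bar R) :
  mu.-integrable setT f -> (forall x, 0 <= f x) ->
  exists P : {finite_measure set X -> \bar R},
    [/\ P `<< mu, ae_eq mu setT (RN_deriv P mu) f &
      forall g : X -> \bar R, measurable_fun setT g -> (forall x, 0 <= g x) ->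
        \int[P]_x g x = \int[mu]_x (g x * f x)].
Proof.
move=> intf f0; have mf := measurable_int _ intf.
pose m A := \int[mu]_(x in A) f x.
have m0 : m set0 = 0 by rewrite /m integral_set0.
have m_ge0 A : 0 <= m A by exact: integral_ge0.
have m_add : semi_sigma_additive m by exact: semi_sigma_additive_nng_induced.
pose mM : {measure set X -> \bar R} :=
  HB.pack m (isMeasure.Build _ _ _ m m0 m_ge0 m_add).
have mfin : fin_num_fun (mM : set X -> \bar R).
  by move=> A mA; apply: integrable_fin_num => //; exact: integrableS intf.
pose P : {finite_measure set X -> \bar R} :=
  HB.pack m mM (Measure_isFinite.Build _ _ _ mM mfin).
have Pmu : P `<< mu.
  apply/null_content_dominatesP => A mA A0.
  by apply: null_set_integral => //; exact: measurable_funTS.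
have RNf : ae_eq mu setT (RN_deriv P mu) f.
  apply: integral_ae_eq => //; first exact: Radon_Nikodym_SigmaFinite.f_integrable.
  by move=> A _ mA; rewrite -Radon_Nikodym_SigmaFinite.f_integral.
exists P; split => // g mg g0.
rewrite -(Radon_Nikodym_SigmaFinite.change_of_variables Pmu)//.
have mRN := measurable_int _ (Radon_Nikodym_SigmaFinite.f_integrable Pmu).
apply: ge0_ae_eq_integral => //.
- exact: emeasurable_funM.
- exact: emeasurable_funM.
- by move=> x _; rewrite mule_ge0// Radon_Nikodym_SigmaFinite.f_ge0.
- by move=> x _; rewrite mule_ge0.
- by apply: filterS RNf => x + _ => ->.
Qed.

End density_measure.

(** * Prices supporting the optimum *)

Section pricing.
Context d (X : measurableType d) (R : realType).
Variables (H : set (probability X R)) (Qa : {finite_measure set X -> \bar R}).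
Variables (U : \bar R -> \bar R) (es : X -> \bar R).
Hypothesis Qa_negl : forall A, hyp_negligible H A -> Qa A = 0.
Hypothesis mU : measurable_fun [set z : \bar R | 0 <= z] U.
Hypotheses (concU : concave_nneg U) (ndU : nondecreasing_nneg U).
Hypothesis finU : finite_pos U.
Hypothesis es_ev : evalue H es.
Hypothesis Ues_fin : Qa (~` [set x | U (es x) \is a fin_num]) = 0.
Hypothesis foc : integrable_first_order H Qa U es.

Let mes : measurable_fun setT es. Proof. by case: es_ev. Qed.
Let es0 x : 0 <= es x. Proof. by case: es_ev. Qed.

Let regular := [set x | es x \is a fin_num] `&` [set x | U (es x) \is a fin_num].

Let mregular : measurable regular.
Proof.
apply: measurableI; rewrite -[X in measurable X]setTI; apply: emeasurable_fin_num => //.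
exact: measurable_utility.
Qed.

Let regularN0 : Qa (~` regular) = 0.
Proof.
have mfin (f : X -> \bar R) : measurable_fun setT f ->
    measurable (~` [set x : X | f x \is a fin_num]).
  move=> mf; apply: measurableC.
  by rewrite -[X in measurable X]setTI; exact: emeasurable_fin_num.
apply: measure_negligible; first exact: measurableC.
rewrite setCI; apply: negligibleU.
- apply/negligibleP; first exact: mfin.
  apply: (evalue_fin Qa_negl) => // P HP; case: es_ev => _ _ /(_ _ HP) h.
  by rewrite (le_lt_trans h) ?ltry.
- by apply/negligibleP => //; apply: mfin; exact: measurable_utility.
Qed.

Let regularP x : regular x ->
  exists r, [/\ es x = r%:E, (0 <= r)%R & U r%:E \is a fin_num].
Proof.
move=> [/= esf Uf]; exists (fine (es x)); rewrite fineK//; split=> //.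
exact: fine_ge0.
Qed.

(** Slopes of [U] at [es], multiplied by [es]: to the right for [a], to the left
    for [b]. Where [es = 0] both vanish, and [c] is the right derivative there. *)
Let a : X -> R := (fun x => fine (dir_deriv U (es x) (2%:E * es x))) \_ regular.
Let b : X -> R := (fun x => - fine (dir_deriv U (es x) 0))%R \_ regular.
Let c : X -> \bar R :=
  (fun x => dir_deriv U (es x) 1) \_ (regular `&` es @^-1` [set 0]).

Let mc : measurable_fun setT c.
Proof.
have mZ : measurable (regular `&` es @^-1` [set 0]).
  by apply: measurableI => //; rewrite -[X in measurable X]setTI; exact: mes.
apply/(measurable_restrictT _ mZ).
by apply: measurable_funTS; exact: measurable_dir_deriv.
Qed.

Let ma : measurable_fun setT a.
Proof.
apply/(measurable_restrictT _ mregular); apply: measurable_funTS.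
apply: (@measurableT_comp _ _ _ _ _ _ fine) => //.
apply: measurable_dir_deriv => //.
- exact: measurable_funeM.
- by move=> x; rewrite mule_ge0.
Qed.

Let mb : measurable_fun setT b.
Proof.
apply/(measurable_restrictT _ mregular); apply: measurable_funTS.
apply: measurable_funN.
apply: (@measurableT_comp _ _ _ _ _ _ fine) => //.
by apply: measurable_dir_deriv.
Qed.

Let aE x r : regular x -> es x = r%:E ->
  a x = fine (dir_deriv U r%:E (2 * r)%:E).
Proof. by move=> rx xr; rewrite /a patchE mem_set// xr. Qed.

Let bE x r : regular x -> es x = r%:E ->
  b x = (- fine (dir_deriv U r%:E 0%:E))%R.
Proof. by move=> rx xr; rewrite /b patchE mem_set// xr. Qed.

Let abx x : (0 <= a x <= b x)%R.
Proof.
have [rx|nrx] := pselect (regular x); last first.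
  by rewrite /a /b !patchE memNset//= lexx.
have [r [xr r0 Ur]] := regularP rx.
by rewrite (aE rx xr) (bE rx xr); exact: slopes_bounds.
Qed.

Let b0 x : fine (es x) = 0%R -> b x = 0%R.
Proof.
move=> x0; have [rx|nrx] := pselect (regular x); last first.
  by rewrite /b patchE memNset.
have [r [xr r0 Ur]] := regularP rx; rewrite (bE rx xr).
by move: x0 Ur; rewrite xr /= => -> Ur; rewrite dir_derivxx// oppr0.
Qed.

Let c_ge0 x : 0 <= c x.
Proof.
rewrite /c patchE; case: ifPn => //; rewrite inE => -[rx /= x0].
have [r [xr r0 Ur]] := regularP rx; rewrite xr; apply: dir_deriv_ge0 => //.
by move: xr; rewrite x0 => -[<-].
Qed.

Let cN0 x : es x != 0 -> c x = 0.
Proof. by move=> x0; rewrite /c patchE memNset// => -[_ /= /eqP]; apply/negP. Qed.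

(** An e-value is replaced by [es * w] where [es] is nonzero, with [w] simple, and
    kept where [es = 0], a region where only increases are possible. *)
Lemma dir_deriv_split x (w : R) (y : \bar R) : regular x -> (0 <= w)%R ->
  0 <= y -> y \is a fin_num ->
  dir_deriv U (es x) (if es x == 0 then y else es x * w%:E) =
  (- Num.max (a x * (1 - w)) (b x * (1 - w)))%:E + c x * y.
Proof.
move=> rx w0 y0 yf; have [r [xr r0 Ur]] := regularP rx.
case: ifPn => [x0|x0]; last first.
  rewrite cN0// mul0e adde0 xr -EFinM dir_deriv_scaled//.
  by rewrite (aE rx xr) (bE rx xr).
have r00 : r = 0%R by move: x0; rewrite xr => /eqP[].
have bx : b x = 0%R by rewrite b0// xr r00.
have ax : a x = 0%R.
  by have := abx x; rewrite bx => /andP[? ?]; apply/eqP; rewrite eq_le; apply/andP.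
rewrite ax bx !mul0r maxxx oppr0 add0e xr r00 -(fineK yf) dir_deriv_at0 ?fine_ge0//.
  rewrite muleC; congr (_ * _); rewrite /c patchE mem_set; last first.
    by split => //=; apply/eqP.
  by rewrite xr r00.
by rewrite -r00.
Qed.

(** Any number between the two slopes is a supergradient; where [es = 0] the least
    supergradient is the right derivative. *)
Lemma dir_deriv_price x (q z : R) : regular x -> (a x <= q <= b x)%R ->
  c x \is a fin_num -> (0 <= z)%R ->
  U z%:E - U (es x) <=
  ((q / fine (es x) + fine (c x)) * (z - fine (es x)))%:E.
Proof.
move=> rx /andP[aq qb] cf z0; have [r [xr r0 Ur]] := regularP rx.
rewrite xr /=; apply: le_trans (sub_le_dir_deriv _ _ _ _ _ _) _ => //.
have [r00|rn0] := eqVneq r 0%R.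
  have bx : b x = 0%R by rewrite b0// xr r00.
  rewrite r00 invr0 mulr0 add0r subr0 EFinM fineK// muleC.
  rewrite dir_deriv_at0//; last by rewrite -r00.
  rewrite /c patchE mem_set ?xr ?r00//.
  by split => //=; rewrite xr r00.
have w0 : (0 <= z / r)%R by rewrite divr_ge0.
have {1}-> : (z = r * (z / r))%R by rewrite mulrC divfK.
rewrite dir_deriv_scaled// -(aE rx xr) -(bE rx xr) cN0 ?xr// addr0 lee_fin.
have -> : (q / r * (z - r) = - (q * (1 - z / r)))%R by field.
rewrite lerN2 le_max.
have [h|h] := leP 0%R (1 - z / r)%R.
  by rewrite orbC ler_wpM2r.
by rewrite ler_wnM2r// ltW.
Qed.

Let zero_evalue : evalue H (cst 0).
Proof. by split=> // P HP; rewrite integral0 lee_fin. Qed.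

Let intb : Qa.-integrable setT (EFin \o b).
Proof.
apply: (integrable_conull mregular regularN0); first exact/measurable_EFinP.
have [intD _] := foc zero_evalue.
apply: (@eq_integrable _ _ _ _ _ mregular (\- (fun x => dir_deriv U (es x) 0))).
  move=> x; rewrite inE => rx /=; have [r [xr r0 Ur]] := regularP rx.
  by rewrite (bE rx xr) xr EFinN fineK// dir_deriv0_fin.
by apply: integrableN => //; exact: integrableS intD.
Qed.

Import HBSimple.

(** Minus the directional derivative of [U] at [es] in the direction [- es * v]. *)
Let Phi (v : {sfun X >-> R}) x := Num.max (a x * v x)%R (b x * v x)%R.

Let intPhi v : Qa.-integrable setT (EFin \o Phi v).
Proof.
apply: (@le_integrable _ _ _ _ _ measurableT _ (EFin \o (b \* v)%R)) => //.
- apply/measurable_EFinP; apply: measurable_maxr; exact: measurable_funM.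
- move=> x _ /=; rewrite lee_fin; have /andP[a0 ab] := abx x.
  rewrite normrM (ger0_norm (le_trans a0 ab)) /Phi.
  have h (y : R) : (0 <= y <= b x)%R -> (`|y * v x| <= b x * `|v x|)%R.
    by move=> /andP[y0 yb]; rewrite normrM ger0_norm// ler_wpM2r.
  rewrite /Num.max; case: ifPn => _; apply: h; rewrite ?a0//.
  by rewrite (le_trans a0 ab) lexx.
- by apply: (integrableMl measurableT intb) => //; exact: simple_bounded.
Qed.

Let S (v : {sfun X >-> R}) : R := (\int[Qa]_x Phi v x)%R.

Let SE v : (S v)%:E = \int[Qa]_x (Phi v x)%:E.
Proof.
rewrite /S /Rintegral fineK//.
exact: (integrable_fin_num measurableT (intPhi v)).
Qed.

Let sublinS : sublinear S.
Proof.
split=> [u v|k v k0].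
  rewrite /S -RintegralD//; apply: le_Rintegral => //.
    exact: (integrableD measurableT (intPhi u) (intPhi v)).
  move=> x _; rewrite /Phi /= !mulrDr ge_max.
  by apply/andP; split; apply: lerD; rewrite le_max lexx ?orbT.
rewrite /S -RintegralZl//; apply: eq_Rintegral => x _.
by rewrite /Phi /= maxr_pMr ?ltW// !(mulrCA k).
Qed.

Let intce (e : X -> \bar R) := \int[Qa]_x (c x * e x).

(** The first-order condition for the e-value equal to [es * w] where [es] is
    nonzero and to [e] elsewhere; it lies below [e]. *)
Lemma constraint_le_support (w : {sfun X >-> R}) (e : X -> \bar R) : (forall x, 0 <= w x)%R ->
  evalue H e -> (forall x, es x * (w x)%:E <= e x) ->
  intce e <= (S (1 - w))%:E.
Proof.
move=> w0 [me e0 eP] we.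
pose e' x := if es x == 0 then e x else es x * (w x)%:E.
have e'e x : e' x <= e x by rewrite /e'; case: ifP.
have e'0 x : 0 <= e' x by rewrite /e'; case: ifP => // _; rewrite mule_ge0// lee_fin.
have me' : measurable_fun setT e'.
  apply: measurable_fun_ifT => //.
  - apply: (measurable_fun_bool true); rewrite setTI.
    rewrite (_ : _ @^-1` _ = es @^-1` [set 0]); last first.
      by apply/seteqP; split=> x /= /eqP.
    by rewrite -[X in measurable X]setTI; exact: mes.
  - apply: emeasurable_funM => //; exact/measurable_EFinP.
have e'_ev : evalue H e'.
  split=> // P HP; apply: le_trans (eP _ HP); exact: ge0_le_integral.
have [intD D0] := foc e'_ev.
have mfine : measurable [set x | e x \is a fin_num].
  by rewrite -[X in measurable X]setTI; exact: emeasurable_fin_num.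
pose G := regular `&` [set x | e x \is a fin_num].
have mG : measurable G by exact: measurableI.
have G0 : Qa (~` G) = 0.
  apply: measure_negligible; first exact: measurableC.
  rewrite setCI; apply: negligibleU.
    by apply/negligibleP => //; exact: measurableC.
  apply/negligibleP; first exact: measurableC.
  by apply: (evalue_fin Qa_negl) => // P HP; rewrite (le_lt_trans (eP _ HP)) ?ltry.
have mce : measurable_fun setT (fun x => c x * e x) by exact: emeasurable_funM.
rewrite /intce (integral_conull mG G0 mce) SE.
rewrite (integral_conull mG G0); last exact: (measurable_int _ (intPhi _)).
have intDG : Qa.-integrable G (fun x => dir_deriv U (es x) (e' x)).
  exact: integrableS intD.
have intPG : Qa.-integrable G (EFin \o Phi (1 - w)%R).
  exact: integrableS (intPhi _).
rewrite (integral_conull mG G0) in D0; last exact: (measurable_int _ intD).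
rewrite (_ : \int[Qa]_(x in G) (c x * e x) = \int[Qa]_(x in G)
    (dir_deriv U (es x) (e' x) + (Phi (1 - w)%R x)%:E)); last first.
  apply: eq_integral => x; rewrite inE => -[rx ef].
  rewrite dir_deriv_split// addeAC -EFinD addNr.
  by rewrite add0e.
rewrite integralD//=.
by rewrite -[leRHS]add0e leeD2r.
Qed.

(** The e-values are homogenized by the level [k], so that the constraints form a
    cone. *)
Let feasible (k : R) (w : {sfun X >-> R}) (e : X -> \bar R) :=
  [/\ (0 < k)%R, forall x, (0 <= w x)%R, measurable_fun setT e,
     forall x, es x * (w x)%:E <= e x &
     forall P, H P -> \int[P]_x e x <= k%:E].

Let feasible_ge0 k w e x : feasible k w e -> 0 <= e x.
Proof.
by move=> [_ w0 _ we _]; apply: le_trans (we x); rewrite mule_ge0// lee_fin.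
Qed.

Let K : set ({sfun X >-> R} * R)%type :=
  [set v : ({sfun X >-> R} * R)%type | exists k w e,
  [/\ feasible k w e, v.1 = (k *: (1 : {sfun X >-> R}) - w)%R & v.2%:E = intce e]].

Let mce e : measurable_fun setT e -> measurable_fun setT (fun x => c x * e x).
Proof. by move=> me; exact: emeasurable_funM. Qed.

Let coneK : convex_cone K.
Proof.
split.
- exists (1%R, 0%R), 1%R, 0%R, (cst 0); split.
  + split=> //; first by move=> x; rewrite mule0.
    by move=> P HP; rewrite integral0 lee_fin.
  + by rewrite scale1r subr0.
  + by rewrite /intce; under eq_integral do rewrite mule0; rewrite integral0.
- move=> [v1 v2] [u1 u2] [k [w [e [fe /= -> v2E]]]] [l [w' [e' [fe' /= -> u2E]]]].
  have [k0 w0 me we eP] := fe; have [l0 w'0 me' we' e'P] := fe'.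
  have e0 x := feasible_ge0 x fe; have e'0 x := feasible_ge0 x fe'.
  exists (k + l)%R, (w + w')%R, (fun x => e x + e' x); split => /=.
  + split=> //.
    * by rewrite addr_gt0.
    * by move=> x; rewrite sfunD addr_ge0.
    * exact: emeasurable_funD.
    * by move=> x; rewrite sfunD EFinD ge0_muleDr ?lee_fin// leeD.
    * by move=> P HP; rewrite ge0_integralD// EFinD leeD ?eP ?e'P.
  + by rewrite scalerDl opprD addrACA.
  + rewrite EFinD v2E u2E /intce -ge0_integralD//; last 4 first.
    * by move=> x _; rewrite mule_ge0.
    * exact: mce.
    * by move=> x _; rewrite mule_ge0.
    * exact: mce.
    by apply: eq_integral => x _; rewrite ge0_muleDr.
- move=> t [v1 v2] t0 [k [w [e [fe /= -> v2E]]]].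
  have [k0 w0 me we eP] := fe; have e0 x := feasible_ge0 x fe.
  exists (t * k)%R, (t *: w)%R, (fun x => t%:E * e x); split => /=.
  + split=> //.
    * by rewrite mulr_gt0.
    * by move=> x; rewrite sfunZ mulr_ge0// ltW.
    * exact: measurable_funeM.
    * by move=> x; rewrite sfunZ EFinM muleCA lee_pmul2l.
    * move=> P HP; rewrite ge0_integralZl_EFin// ?(ltW t0)// EFinM lee_pmul2l//.
      exact: eP.
  + by rewrite scalerBr scalerA.
  + rewrite EFinM v2E /intce -ge0_integralZl_EFin// ?(ltW t0)//; last 2 first.
    * by move=> x _; rewrite mule_ge0.
    * exact: mce.
    by apply: eq_integral => x _; rewrite muleCA.
Qed.

Let KS v : K v -> (v.2 <= S v.1)%R.
Proof.
case: v => v1 v2 [k [w [e [fe /= -> v2E]]]].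
have [k0 w0 me we eP] := fe; have e0 x := feasible_ge0 x fe.
have ki0 : (0 < k^-1)%R by rewrite invr_gt0.
have -> : (k *: (1 : {sfun X >-> R}) - w = k *: (1 - k^-1 *: w))%R.
  by rewrite scalerBr scalerA divff ?gt_eqF// scale1r.
rewrite sublinS.2// -ler_pdivrMl// -lee_fin EFinM v2E.
rewrite /intce -ge0_integralZl_EFin// ?(ltW ki0)//; last 2 first.
- by move=> x _; rewrite mule_ge0.
- exact: mce.
under eq_integral do rewrite muleCA.
apply: (@constraint_le_support (k^-1 *: w)%R (fun x => (k^-1)%:E * e x)).
- by move=> x; rewrite sfunZ mulr_ge0// ltW.
- split.
  + exact: measurable_funeM.
  + by move=> x; rewrite mule_ge0// lee_fin ltW.
  + move=> P HP; rewrite ge0_integralZl_EFin// ?(ltW ki0)//.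
    apply: (@le_trans _ _ ((k^-1)%:E * k%:E)); first by rewrite lee_pmul2l// eP.
    by rewrite -EFinM mulVf// gt_eqF.
- by move=> x; rewrite sfunZ EFinM muleCA lee_pmul2l.
Qed.

(** Mazur-Orlicz chooses one linear functional for all e-values at once, and its
    bounds on indicators provide the density [q]. The inequality is linear in
    [(w, e)], whereas the first-order condition is not. *)
Theorem price_density : exists q : X -> R,
  [/\ measurable_fun setT q, forall x, (a x <= q x <= b x)%R &
    forall (w : {sfun X >-> R}) e, (forall x, 0 <= w x)%R -> evalue H e ->
      (forall x, es x * (w x)%:E <= e x) ->
      \int[Qa]_x (q x * w x)%:E + intce e <= \int[Qa]_x (q x)%:E].
Proof.
have [L [linL LS KL]] := mazur_orlicz sublinS coneK KS.
have LB u v : (L (u - v) = L u - L v)%R.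
  by rewrite addrC -scaleN1r linL mulN1r addrC.
have L0 : L 0%R = 0%R by rewrite -(subrr 0%R) LB subrr.
have abL A (mA : measurable A) : \int[Qa]_(x in A) (a x)%:E <=
    (L (indic_sfun A mA))%:E <= \int[Qa]_(x in A) (b x)%:E.
  apply/andP; split.
    rewrite -leeN2 -EFinN -sub0r -{1}L0 -LB.
    apply: (@le_trans _ _ (S (0 - indic_sfun A mA)%R)%:E); first by rewrite lee_fin LS.
    rewrite SE -integral_ge0N; last by move=> x _; rewrite lee_fin; case/andP: (abx x).
    rewrite [leRHS]integral_mkcond.
    rewrite le_eqVlt; apply/orP; left; apply/eqP; apply: eq_integral => x _.
    rewrite /Phi patchE sfunB /= /mindic indicE sub0r.
    case: (x \in A); last by rewrite oppr0 !mulr0 maxxx.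
    by rewrite !mulrN1 (max_idPl _)// lerN2; case/andP: (abx x).
  apply: (@le_trans _ _ (S (indic_sfun A mA))%:E); first by rewrite lee_fin LS.
  rewrite SE [leRHS]integral_mkcond.
  rewrite le_eqVlt; apply/orP; left; apply/eqP; apply: eq_integral => x _.
  rewrite /Phi patchE /= /mindic indicE.
  case: (x \in A); last by rewrite !mulr0 maxxx.
  by rewrite !mulr1 (max_idPr _)//; case/andP: (abx x).
have a0 x : (0 <= a x)%R by case/andP: (abx x).
have ab x : (a x <= b x)%R by case/andP: (abx x).
have [q [mq aqb Lq]] := sfun_functional_density ma mb a0 ab intb linL abL.
exists q; split=> // w e w0 e_ev we.
have [me e0 eP] := e_ev.
have ce0 : 0 <= intce e by apply: integral_ge0 => x _; rewrite mule_ge0.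
have cef : intce e \is a fin_num.
  by rewrite ge0_fin_numE// (le_lt_trans (constraint_le_support w0 e_ev we)) ?ltry.
have : K (1 *: (1 : {sfun X >-> R}) - w, fine (intce e))%R.
  by exists 1%R, w, e; split; [split|by []|rewrite /= fineK].
move=> /KL /=; rewrite scale1r LB -lee_fin fineK// EFinB => h.
rewrite -Lq -leeBrDl//.
apply: le_trans h _; rewrite leeD2r// Lq le_eqVlt; apply/orP; left; apply/eqP.
by apply: eq_integral => x _; rewrite mulr1.
Qed.

Import HBNNSimple.

(** The price is [q / es] where [es] is nonzero and [c] elsewhere. The budget
    inequality is that of [price_density] along simple functions increasing
    to [e / es]. Since [q] vanishes where [es] does, [p * es = q] pointwise, so
    [es] exhausts the budget. *)
Theorem supporting_price : exists (lam : R) (p : X -> R),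
  [/\ (0 <= lam)%R, measurable_fun setT p, forall x, (0 <= p x)%R,
    (forall e, evalue H e -> \int[Qa]_x ((p x)%:E * e x) <= lam%:E) /\
    \int[Qa]_x ((p x)%:E * es x) = lam%:E &
    {ae Qa, forall x, exists r : R, [/\ es x = r%:E, (0 <= r)%R,
      U r%:E \is a fin_num &
      forall z, (0 <= z)%R -> U z%:E - U r%:E <= (p x * (z - r))%:E]}].
Proof.
have [q [mq aqb qP]] := price_density.
have q0 x : (0 <= q x)%R.
  by have /andP[a0 _] := abx x; have /andP[aq _] := aqb x; exact: le_trans aq.
have q_eq0 x : fine (es x) = 0%R -> q x = 0%R.
  move=> esx0; have /andP[_ ] := aqb x; rewrite b0// => qx0.
  by apply/eqP; rewrite eq_le qx0 q0.
have intq : Qa.-integrable setT (EFin \o q).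
  apply: le_integrable intb => //; first exact/measurable_EFinP.
  move=> x _ /=; have /andP[a0 _] := abx x; have /andP[_ qb] := aqb x.
  by rewrite lee_fin !ger0_norm// (le_trans (q0 x)).
pose ies x := ((fine (es x))^-1)%R.
have ies0 x : (0 <= ies x)%R by rewrite invr_ge0 fine_ge0.
have mies : measurable_fun setT ies.
  apply: (@measurableT_comp _ _ _ _ _ _ (@GRing.inv R)); first exact: measurable_inv.
  exact: (@measurableT_comp _ _ _ _ _ _ fine).
(* the inverse of 0, and of the finite part of +oo, is 0, and q vanishes there *)
pose p x := (q x * ies x)%:E + c x.
have p0 x : 0 <= p x by rewrite adde_ge0// lee_fin mulr_ge0.
have mp : measurable_fun setT p.
  by apply: emeasurable_funD => //; apply/measurable_EFinP; exact: measurable_funM.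
pose lam := (\int[Qa]_x q x)%R.
have lamE : lam%:E = \int[Qa]_x (q x)%:E.
  by rewrite /lam /Rintegral fineK//; exact: (integrable_fin_num measurableT intq).
have p_le e : evalue H e -> \int[Qa]_x (p x * e x) <= lam%:E.
  move=> e_ev; have [me e0 _] := e_ev.
  pose f x := (ies x)%:E * e x.
  have f0 x : 0 <= f x by rewrite mule_ge0// lee_fin.
  have mf : measurable_fun setT f.
    by apply: emeasurable_funM => //; exact/measurable_EFinP.
  have -> : \int[Qa]_x (p x * e x) = \int[Qa]_x ((q x)%:E * f x) + intce e.
    rewrite /intce -ge0_integralD//; last 4 first.
    - by move=> x _; rewrite mule_ge0// lee_fin.
    - by apply: emeasurable_funM => //; exact/measurable_EFinP.
    - by move=> x _; rewrite mule_ge0.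
    - exact: mce.
    apply: eq_integral => x _; rewrite /p ge0_muleDl ?lee_fin ?mulr_ge0//.
    by rewrite EFinM -muleA.
  pose w_ := nnsfun_approx measurableT mf.
  have wf x : (w_ n x)%:E @[n --> \oo] --> f x.
    exact: (cvg_nnsfun_approx measurableT mf (fun x _ => f0 x) Logic.I).
  have wnd x n m : (n <= m)%N -> (w_ n x <= w_ m x)%R.
    by move=> nm; exact/lefP/nd_nnsfun_approx.
  have w_le n x : (w_ n x)%:E <= f x.
    apply: (cvge_ge _ (wf x)); near=> m; rewrite lee_fin; apply: wnd.
    by near: m; exists n.
  have w_ok n x : es x * (w_ n x)%:E <= e x.
    apply: (@le_trans _ _ (es x * f x)); first by rewrite lee_wpmul2l.
    rewrite /f /ies; move: (es0 x); case: (es x) => [r| |]//= r0.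
      have [->|rn0] := eqVneq r 0%R; first by rewrite mul0e.
      by rewrite muleA -EFinM divff// mul1e.
    by rewrite invr0 mul0e mule0.
  have bound n : \int[Qa]_x (q x * w_ n x)%:E + intce e <= lam%:E.
    by rewrite lamE; apply: qP => // x; exact: w_ok.
  have ce0 : 0 <= intce e by apply: integral_ge0 => x _; rewrite mule_ge0.
  have cef : intce e \is a fin_num.
    rewrite ge0_fin_numE//; apply: (@le_lt_trans _ _ lam%:E); last exact: ltry.
    apply: le_trans (bound 0%N); rewrite -[leLHS]add0e leeD2r//.
    by apply: integral_ge0 => x _; rewrite lee_fin mulr_ge0.
  rewrite -leeBrDr//.
  have -> : \int[Qa]_x ((q x)%:E * f x) =
      \int[Qa]_x limn (fun n => (q x * w_ n x)%:E).
    apply: eq_integral => x _; apply/esym/cvg_lim => //.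
    by under eq_fun do rewrite EFinM; apply: cvgeZl.
  rewrite monotone_convergence//; last 3 first.
  - move=> n; apply/measurable_EFinP; exact: measurable_funM.
  - by move=> n x _; rewrite lee_fin mulr_ge0.
  - by move=> x _ n m nm; rewrite lee_fin ler_wpM2l// wnd.
  apply: lime_le.
    apply: ereal_nondecreasing_is_cvgn => n m nm; apply: ge0_le_integral => //.
    - by move=> x _; rewrite lee_fin mulr_ge0.
    - by apply/measurable_EFinP; exact: measurable_funM.
    - by apply/measurable_EFinP; exact: measurable_funM.
    - by move=> x _; rewrite lee_fin ler_wpM2l// wnd.
  by apply: nearW => n; rewrite leeBrDr.
have p_es x : p x * es x = (q x)%:E.
  rewrite /p ge0_muleDl ?lee_fin ?mulr_ge0//.
  have [esx0|esx0] := eqVneq (es x) 0.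
    by rewrite esx0 !mule0 adde0 q_eq0// esx0.
  rewrite cN0// mul0e adde0 /ies; move: esx0 (es0 x) (q_eq0 x).
  case: (es x) => [r| |]//= r0 _ qr0; last by rewrite qr0// mul0r mul0e.
  by rewrite -EFinM divfK.
have one_ev : evalue H (cst 1).
  by split=> // P HP; rewrite integral_cst// mul1e probability_le1.
have pfin : {ae Qa, forall x, p x \is a fin_num}.
  have intp : Qa.-integrable setT p.
    apply/integrableP; split=> //; under eq_integral do rewrite gee0_abs//.
    apply: le_lt_trans (ltry lam); apply: le_trans (p_le _ one_ev).
    by under [leRHS]eq_integral do rewrite mule1.
  by apply: filterS (integrable_ae measurableT intp) => x; exact.
have p_fine e : measurable_fun setT e -> (forall x, 0 <= e x) ->
    \int[Qa]_x ((fine (p x))%:E * e x) = \int[Qa]_x (p x * e x).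
  move=> me e0; apply: ge0_ae_eq_integral => //.
  - apply: emeasurable_funM => //; apply/measurable_EFinP.
    exact: (@measurableT_comp _ _ _ _ _ _ fine).
  - exact: emeasurable_funM.
  - by move=> x _; rewrite mule_ge0// lee_fin fine_ge0.
  - by move=> x _; rewrite mule_ge0.
  - by apply: filterS pfin => x px _; rewrite fineK.
exists lam, (fine \o p); split.
- by apply: Rintegral_ge0.
- exact: measurableT_comp.
- by move=> x; exact: fine_ge0.
- split; first by move=> e e_ev; have [me e0 _] := e_ev; rewrite p_fine// p_le.
  by rewrite p_fine// lamE; apply: eq_integral => x _; rewrite p_es.
- apply: filterS2 pfin (ae_conull mregular regularN0) => x px rx.
  have [r [xr r0 Ur]] := regularP rx; exists r; split=> // z z0.
  have cf : c x \is a fin_num by move: px; rewrite /p fin_numD => /andP[].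
  have := dir_deriv_price rx (aqb x) cf z0.
  by rewrite /= /p fineD//= /ies xr; exact.
Unshelve. all: by end_near. Qed.

End pricing.

(** * Optimality conditions *)

Theorem corollary3 (d : measure_display) (X : measurableType d) (R : realType)
    (H : set (probability X R)) (Q : probability X R)
    (Qa Qs : {finite_measure set X -> \bar R})
    (U : \bar R -> \bar R) (es : X -> \bar R)
    (HQ : generalized_Lebesgue_decomposition H Q Qa Qs)
    (mU : measurable_fun [set z : \bar R | 0 <= z] U)
    (concU : concave_nneg U) (ndU : nondecreasing_nneg U)
    (finU : finite_pos U)
    (es_opt : U_optimal H Qa U es)
    (es_scale : exists a : R, (0 < a < 1)%R /\
       \int[Qa]_x (U (es x) - U (a%:E * es x)) < +oo) :
  integrable_first_order H Qa U es /\
  exists (lam : R) (P : {finite_measure set X -> \bar R}),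
    [/\ (0 <= lam)%R,
        effective_hyp H P,
        P `<< Qa,
        {ae Qa, forall x, exists2 r : R, es x = r%:E &
           argmax_nneg (fun z => U z%:E - lam%:E * RN_deriv P Qa x * z%:E) r}
      & lam%:E * (1 - \int[P]_x es x) = 0].
Proof.
have [_ _ Qa_negl] := HQ.
have foc := optimum_first_order Qa_negl mU concU ndU finU es_opt es_scale.
split=> //.
have Ues_fin := utility_optimum_fin mU es_opt.
have [es_ev _] := es_opt; have [mes es0 _] := es_ev.
have [lam [p [lam0 mp p0 [p_le p_es] p_sub]]] :=
  supporting_price Qa_negl mU concU ndU finU es_ev Ues_fin foc.
have one_ev : evalue H (cst 1).
  by split=> // P HP; rewrite integral_cst// mul1e probability_le1.
have p_le_lam : \int[Qa]_x (p x)%:E <= lam%:E.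
  by have := p_le _ one_ev; under eq_integral do rewrite mule1.
have intp : Qa.-integrable setT (EFin \o p).
  apply/integrableP; split; first exact/measurable_EFinP.
  under eq_integral do rewrite gee0_abs ?lee_fin//.
  by rewrite (le_lt_trans p_le_lam) ?ltry.
(* when lam = 0 the price has integral 0, hence vanishes almost everywhere *)
have p_lam : ae_eq Qa setT (fun x => (lam * (lam^-1 * p x))%:E) (EFin \o p).
  have [l0|l0] := eqVneq lam 0%R; last first.
    by apply: aeW => x _ /=; rewrite mulrA divff// mul1r.
  have : ae_eq Qa setT (EFin \o p) (cst 0).
    apply/ae_eq_integral_abs => //; first exact/measurable_EFinP.
    under eq_integral do rewrite gee0_abs ?lee_fin//.
    apply/eqP; rewrite eq_le integral_ge0 ?andbT; last by move=> x _; rewrite lee_fin.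
    by move: p_le_lam; rewrite l0.
  by apply: filterS => x /(_ Logic.I) /= px _; rewrite px l0 mul0r.
pose f x := (lam^-1 * p x)%:E.
have f0 x : 0 <= f x by rewrite lee_fin mulr_ge0// invr_ge0.
have intf : Qa.-integrable setT f.
  have -> : f = (fun x => (lam^-1)%:E * (EFin \o p) x) by [].
  exact: integrableZl.
have [P [PQa RNf intP]] := measure_with_density intf f0.
have intPE e : measurable_fun setT e -> (forall x, 0 <= e x) ->
    \int[P]_x e x = (lam^-1)%:E * \int[Qa]_x ((p x)%:E * e x).
  move=> me e0; rewrite intP// -ge0_integralZl_EFin ?invr_ge0//; last 2 first.
  - by move=> x _; rewrite mule_ge0// lee_fin.
  - by apply: emeasurable_funM => //; exact/measurable_EFinP.
  by apply: eq_integral => x _; rewrite muleC /f EFinM muleA.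
exists lam, P; split=> //.
- move=> e e_ev; have [me e0 _] := e_ev; rewrite intPE//.
  apply: (@le_trans _ _ ((lam^-1)%:E * lam%:E)).
    by rewrite lee_wpmul2l ?lee_fin ?invr_ge0// p_le.
  rewrite -EFinM lee_fin; have [->|l0] := eqVneq lam 0%R; first by rewrite mulr0.
  by rewrite mulVf.
- apply: filterS3 p_lam RNf p_sub => x /(_ Logic.I) /= plx /(_ Logic.I) RNx.
  move=> [r [xr r0 Ur sub]]; exists r => //; split=> // z z0.
  have -> : lam%:E * RN_deriv P Qa x = (p x)%:E by rewrite RNx /f -EFinM.
  have := sub _ z0; have := U_lty ndU finU z0.
  rewrite -(fineK Ur); case: (U z%:E) => // [u|] _; last first.
    by move=> _; rewrite addNye leNye.
  by rewrite -!EFinM -!EFinB !lee_fin mulrBr; lra.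
- rewrite (intPE es)// p_es -!EFinM; congr EFin.
  have [->|l0] := eqVneq lam 0%R; first by rewrite mul0r.
  by rewrite mulVf// subrr mulr0.
Qed.
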